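(* Let $G$ be an extremely amenable SIN topological group admitting a topologically faithful unitary representation. If $G$ is non-trivial, then $G$ does not have strong property $(T)$.
   Context: All topological groups are Hausdorff. A topological group $G$ is extremely amenable if every continuous action of $G$ on a (non-empty) compact Hausdorff space has a fixed point. $G$ is SIN if conjugation-invariant neighbourhoods of the identity form a neighbourhood basis at the identity. $G$ admits a topologically faithful unitary representation if it embeds as a topological subgroup into $U(\mathcal H)$ with the strong operator topology for some Hilbert space $\mathcal H$. A subset $Q\subseteq G$ is a Kazhdan set if there is $\varepsilon>0$ such that every strongly continuous unitary representation $\pi$ of $G$ that has a unit vector $\xi$ with $\|\xi-\pi_g\xi\|<\varepsilon$ for all $g\in Q$ has an invariant unit vector. $G$ has strong property $(T)$ if it has a finite Kazhdan set. *)

(* Defs.v *)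
From HB Require Import structures.
From mathcomp Require Import all_boot all_order all_algebra.
From mathcomp Require Import complex.
From mathcomp Require Import all_classical all_reals all_analysis.

Set Implicit Arguments.
Unset Strict Implicit.
Unset Printing Implicit Defensive.
Import Order.TTheory GRing.Theory Num.Theory.

Local Open Scope classical_set_scope.
Local Open Scope complex_scope.
Local Open Scope ring_scope.

HB.mixin Record Topological_isTopologicalGroup G
    & Topological G & Group G := {
  mulg_continuous : continuous (fun x : G * G => (x.1 * x.2)%g) ;
  invg_continuous : continuous (fun x : G => (x^-1)%g)
}.

(* Separation is not part of the structure: use [hausdorff_space G]. *)
#[short(type="topologicalGroupType")]
HB.structure Definition TopologicalGroup :=
  {G of Topological G & Group G & Topological_isTopologicalGroup G}.

(* [inner] is linear in its first argument and antilinear in the second. *)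
HB.mixin Record CompleteNormedModule_isHilbert (R : realType) H
    & CompleteNormedModule R[i] H := {
  inner : {dot H for (@Num.conj R[i])} ;
  inner_norm : forall x : H, inner x x = `|x| ^+ 2
}.

#[short(type="hilbertType")]
HB.structure Definition Hilbert (R : realType) :=
  {H of CompleteNormedModule R[i] H & CompleteNormedModule_isHilbert R H}.

Definition unitary_operator (R : realType) (H : hilbertType R)
    (u : H -> H) : Prop :=
  [/\ linear u,
      forall x y : H, inner (u x) (u y) = inner x y
    & forall y : H, exists x : H, u x = y].

Record unitary_group (R : realType) (H : hilbertType R) := Unitary {
  unitary_fun :> H -> H ;
  unitary_funP : unitary_operator unitary_fun
}.

Section UnitaryGroup.
Variables (R : realType) (H : hilbertType R).
Local Notation U := (unitary_group H).
Implicit Types u v w : U.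

HB.instance Definition _ := gen_eqMixin U.
HB.instance Definition _ := gen_choiceMixin U.

(* Strong operator topology: pointwise convergence for the norm of H. *)
HB.instance Definition _ := Topological.copy U
  (initial_topology (@unitary_fun R H : U -> {ptws H -> H})).

Lemma unitary_ext u v : u =1 v -> u = v.
Proof.
case: u v => [f fP] [g gP] /= fg; have {}fg : f = g by exact/funext.
by case: g / fg gP => gP; congr Unitary; exact: Prop_irrelevance.
Qed.

Lemma unitary_inj u : injective u.
Proof.
case: (unitary_funP u) => lin iso _ x y uxy.
have uB : u (x - y) = u x - u y.
  have -> : x - y = - 1 *: y + x by rewrite scaleN1r addrC.
  by rewrite lin scaleN1r addrC.
apply/eqP; rewrite -subr_eq0 -normr_eq0 -sqrf_eq0 -inner_norm -iso.
by rewrite inner_norm uB uxy subrr normr0 expr0n.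
Qed.

Lemma unitary_one_subproof : unitary_operator (@idfun H).
Proof. by split=> // y; exists y. Qed.

Lemma unitary_mul_subproof u v : unitary_operator (u \o v).
Proof.
case: (unitary_funP u) (unitary_funP v) => linu isou suru [linv isov surv].
split=> [a x y|x y|y] /=; first by rewrite linv linu.
  by rewrite isou isov.
by have [x <-] := suru y; have [z <-] := surv x; exists z.
Qed.

Definition unitary_inv_fun u (y : H) : H :=
  let: And3 _ _ sur := unitary_funP u in sval (cid (sur y)).

Lemma unitary_inv_funK u : cancel (unitary_inv_fun u) u.
Proof.
by rewrite /unitary_inv_fun => y; case: unitary_funP => ? ? s; case: cid.
Qed.

Lemma unitary_inv_subproof u : unitary_operator (unitary_inv_fun u).
Proof.
have [lin iso _] := unitary_funP u; have K := unitary_inv_funK u.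
split=> [a x y|x y|y]; last first.
- by exists (u y); apply: (@unitary_inj u); rewrite K.
- by rewrite -iso !K.
- by apply: (@unitary_inj u); rewrite lin !K.
Qed.

Definition unitary_one : U := Unitary unitary_one_subproof.
Definition unitary_mul u v : U := Unitary (unitary_mul_subproof u v).
Definition unitary_inv u : U := Unitary (unitary_inv_subproof u).

Lemma unitary_mulA : associative unitary_mul.
Proof. by move=> u v w; exact: unitary_ext. Qed.

Lemma unitary_mul1u : left_id unitary_one unitary_mul.
Proof. by move=> u; exact: unitary_ext. Qed.

Lemma unitary_mulu1 : right_id unitary_one unitary_mul.
Proof. by move=> u; exact: unitary_ext. Qed.

Lemma unitary_mulVu : left_inverse unitary_one unitary_inv unitary_mul.
Proof.
move=> u; apply: unitary_ext => x /=.
by apply: (@unitary_inj u); rewrite unitary_inv_funK.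
Qed.

Lemma unitary_muluV : right_inverse unitary_one unitary_inv unitary_mul.
Proof. by move=> u; apply: unitary_ext => x /=; exact: unitary_inv_funK. Qed.

HB.instance Definition _ := isGroup.Build U
  unitary_mulA unitary_mul1u unitary_mulu1 unitary_mulVu unitary_muluV.

End UnitaryGroup.

Definition extremely_amenable (G : topologicalGroupType) : Prop :=
  forall (X : topologicalType) (act : G -> X -> X),
    compact [set: X] -> hausdorff_space X -> [set: X] !=set0 ->
    (forall x, act 1%g x = x) ->
    (forall g h x, act (g * h)%g x = act g (act h x)) ->
    continuous (fun p : G * X => act p.1 p.2) ->
    exists x, forall g, act g x = x.

Definition conj_invariant (G : groupType) (V : set G) : Prop :=
  forall g x, V x -> V (x ^ g)%g.

Definition SIN (G : topologicalGroupType) : Prop :=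
  forall W : set G, nbhs 1%g W ->
    exists V : set G, [/\ nbhs 1%g V, conj_invariant V & V `<=` W].

Definition unitary_representation (R : realType) (G : topologicalGroupType)
    (H : hilbertType R) (pi : G -> unitary_group H) : Prop :=
  {morph pi : g h / (g * h)%g} /\ continuous pi.

(* The last clause says that [pi] is open onto its image. *)
Definition topologically_faithful (R : realType) (G : topologicalGroupType)
    (H : hilbertType R) (pi : G -> unitary_group H) : Prop :=
  [/\ unitary_representation pi, injective pi
    & forall A : set G, open A ->
        exists2 B : set (unitary_group H), open B & pi @` A = range pi `&` B].

Definition invariant_vector (R : realType) (G : topologicalGroupType)
    (H : hilbertType R) (pi : G -> unitary_group H) (xi : H) : Prop :=
  forall g, pi g xi = xi.

Definition kazhdan_set (R : realType) (G : topologicalGroupType)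
    (Q : set G) : Prop :=
  exists2 eps : R, 0 < eps &
    forall (H : hilbertType R) (pi : G -> unitary_group H),
      unitary_representation pi ->
      (exists2 xi : H, `|xi| = 1 &
         forall g, Q g -> `|xi - pi g xi| < eps%:C) ->
      exists2 eta : H, `|eta| = 1 & invariant_vector pi eta.

Definition strong_property_T (R : realType) (G : topologicalGroupType) : Prop :=
  exists2 Q : set G, finite_set Q & kazhdan_set R Q.

(* Main.v *)
(** Let [pi] be a nontrivial faithful representation and [xi] a normalized
    vector of the form [pi g xi0 - xi0].  Strong property (T) is contradicted by
    the representation [pi (x) conj pi] of Hilbert-Schmidt operators on the
    span of the orbit of [xi], realised as the reproducing kernel Hilbert space
    on [G * G] with kernel the product of two matrix coefficients.

    Almost invariant vectors.  A fixed point of [G] on the compact convex set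
    of tuples of equi-Lipschitz functions is a tuple of constants; by
    compactness and a minimax argument there are finitely supported probability
    measures [mu] on [G] with [mu (f (q_i _) - f)] small uniformly over such
    functions [f].  Since [G] is SIN, the Lipschitz modulus can be chosen
    bi-invariant, and [A = sum_x mu x (pi x xi) (pi x xi)^*] is then almost
    [q_i]-invariant in trace norm, so that the Powers-Stormer inequality makes
    its square root almost invariant in Hilbert-Schmidt norm.

    No invariant vectors.  An invariant element is an almost periodic function
    on [G], because Hilbert-Schmidt operators are norm limits of finite rank
    ones; the orbit closure being compact, extreme amenability makes it a
    constant [c].  Then [|c| <= |sum_j mu_j pi (x_j) xi|] for all convex
    combinations, while those come arbitrarily close to [0] because [xi] is a
    coboundary; hence [c = 0]. *)

Require Import Defs.
From HB Require Import structures.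
From mathcomp Require Import all_boot all_order all_algebra.
From mathcomp Require Import complex.
From mathcomp Require Import all_classical all_reals all_analysis.
From mathcomp Require Import ring lra.

Set Implicit Arguments.
Unset Strict Implicit.
Unset Printing Implicit Defensive.
Import Order.TTheory GRing.Theory Num.Theory numFieldNormedType.Exports.

Local Open Scope classical_set_scope.
Local Open Scope complex_scope.
Local Open Scope ring_scope.

(** * Translations, pointwise topology and compact subspaces *)

Lemma mulg_continuousl (G : topologicalGroupType) (k : G) :
  continuous (fun h : G => (k * h)%g).
Proof.
move=> g; apply: (@continuous_comp _ _ _ (fun h => (k, h))
  (fun x : G * G => (x.1 * x.2)%g)); last exact: mulg_continuous.
by apply: cvg_pair => /=; [exact: cvg_cst|exact: cvg_id].
Qed.

Lemma mulg_continuousr (G : topologicalGroupType) (k : G) :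
  continuous (fun h : G => (h * k)%g).
Proof.
move=> g; apply: (@continuous_comp _ _ _ (fun h => (h, k))
  (fun x : G * G => (x.1 * x.2)%g)); last exact: mulg_continuous.
by apply: cvg_pair => /=; [exact: cvg_id|exact: cvg_cst].
Qed.

Lemma pointwise_continuous (T : topologicalType) (J : choiceType)
    (V : topologicalType) (f : T -> {ptws J -> V}) :
  (forall j, continuous (fun t => f t j)) -> continuous f.
Proof.
move=> cf t; apply/cvg_sup => j.
exact: (@continuous_comp_initial _ _ _ (fun g : J -> V => g j) f (cf j)).
Qed.

Lemma hausdorff_set_type (T : topologicalType) (A : set T) :
  hausdorff_space T -> hausdorff_space A.
Proof.
move=> hT p q clpq; apply: val_inj; apply: hT => B C nB nC.
have cv : continuous (set_val : A -> T) := @initial_continuous _ _ _.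
by have [z [Bz Cz]] := clpq _ _ (cv p _ nB) (cv q _ nC); exists (set_val z).
Qed.

Lemma compact_set_type (T : topologicalType) (A : set T) :
  compact A -> compact [set: A].
Proof.
move=> cA F FF _.
have FA : (set_val @ F) A.
  by apply: (@filterS _ F _ setT) filterT => /= x _; apply: set_valP.
have [p [Ap clp]] := cA (set_val @ F) _ FA.
exists (exist _ p (mem_set Ap)); split=> // B C FB [D [[W oW <-] /= Wp WC]].
have FB' : (set_val @ F) (set_val @` B).
  by apply: (@filterS _ F _ B) FB => x Bx; exists x.
have [_ [[x Bx <-] Wx]] := clp _ _ FB' (open_nbhs_nbhs (conj oW Wp)).
by exists x; split=> //; exact: WC.
Qed.

(** * Fixed points in compact spaces of functions on the group *)

Section FixedFunction.
Variables (R : realType) (G : topologicalGroupType).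
Hypothesis G_ea : extremely_amenable G.

(** The group acts on [Z] by right translation of the second variable. Equicontinuity makes this
    action jointly continuous for the pointwise topology, so it has a fixed point; right
    translations being transitive on [G], a fixed function does not depend on its group variable. *)
Lemma ea_fixed_function (I : choiceType)
    (Z : set {ptws (I * G)%type -> R}) :
  compact Z -> Z !=set0 ->
  (forall z h, Z z -> Z (fun p => z (p.1, (p.2 * h)%g))) ->
  (forall i g e, 0 < e -> \forall h \near g, forall z, Z z ->
     `|z (i, h) - z (i, g)| < e) ->
  exists2 z, Z z & forall i a b, z (i, a) = z (i, b).
Proof.
move=> cZ [z0 Zz0] Zinv Zeq.
pose act (g : G) (z : Z) : Z :=
  exist _ (fun p => \val z (p.1, (p.2 * g)%g)) (mem_set (Zinv _ g (set_valP z))).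
have hP : hausdorff_space {ptws (I * G)%type -> R}.
  exact: (@hausdorff_product (I * G)%type (fun=> R) (fun=> @Rhausdorff R)).
have [||||||z fz] := G_ea (X := Z) (act := act).
- exact: compact_set_type.
- exact: hausdorff_set_type.
- by exists (exist _ z0 (mem_set Zz0)).
- by move=> z; apply: val_inj; apply/funext => -[i a] /=; rewrite mulg1.
- by move=> g h z; apply: val_inj; apply/funext => -[i a] /=; rewrite mulgA.
- pose F := fun p : G * Z => act p.1 p.2.
  suff cF : continuous (set_val \o F : G * Z -> {ptws (I * G)%type -> R}).
    exact: (@continuous_comp_initial _ _ _ _ F cF).
  apply: pointwise_continuous => -[i a] [g z] /=.
  apply/cvgrPdist_lt => e e0; have e20 : 0 < e / 2 by rewrite divr_gt0.
  have ca : (a * h)%g @[h --> g] --> (a * g)%g by exact: mulg_continuousl.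
  have cv : (fun y : Z => \val y (i, (a * g)%g)) @ z --> \val z (i, (a * g)%g).
    apply: (@continuous_comp _ _ _ (set_val : Z -> {ptws (I * G)%type -> R})
      (fun y => y (i, (a * g)%g))); first exact: initial_continuous.
    exact: (@proj_continuous (I * G)%type (fun=> R) (i, (a * g)%g)).
  move/cvgrPdist_lt: cv => /(_ _ e20) cv.
  (* Equicontinuity controls the change of group element uniformly over [Z]; evaluation at the one
     point [a * g] controls the change of function. *)
  have := ca _ (Zeq i (a * g)%g _ e20); rewrite nbhs_filterE /= => ca'.
  exists ([set h | forall y, Z y -> `|y (i, (a * h)%g) - y (i, (a * g)%g)| < e / 2],
    [set y : Z | `|\val z (i, (a * g)%g) - \val y (i, (a * g)%g)| < e / 2]) => //=.
  move=> [h y] /= [/(_ _ (set_valP y)) h1 h2].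
  rewrite [e]splitr -(subrKA (\val y (i, (a * g)%g))).
  apply: le_lt_trans (ler_normD _ _) _; apply: ltrD => //.
  by rewrite distrC.
exists (\val z); first exact: set_valP.
move=> i a b; have /(congr1 (fun y : Z => \val y (i, a))) /= := fz (a^-1 * b)%g.
by rewrite mulgA mulgV mul1g.
Qed.

End FixedFunction.

(** * A minimax theorem for finitely many affine functions *)

Section Minimax.
Variables (R : realType) (T : Type) (mix : R -> T -> T -> T).

(** [mix t f g] stands for the convex combination with weights [t] and [1 - t]. Abstracting it makes
    the theorem applicable to any set with pointwise mixtures. *)
Definition mix_closed (L : set T) :=
  forall t f g, 0 <= t <= 1 -> L f -> L g -> L (mix t f g).

Definition mix_affine (b : T -> R) :=
  forall t f g, b (mix t f g) = t * b f + (1 - t) * b g.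

(** Unless [c <= 0] on [L], a number [l >= 0] is sought with [l * c f + b f <= 0] on [L]. Elements
    with [c f > 0] bound [l] from above by [- b f / c f], those with [c f < 0] bound it from below,
    and [cross] says that the lower bounds lie under the upper ones. The infimum of the upper bounds
    therefore works, and [t = l / (l + 1)] normalizes the weights. *)
Lemma minimax2 (L : set T) (b c : T -> R) :
  mix_closed L -> mix_affine b -> mix_affine c ->
  (forall f, L f -> 0 < c f -> b f <= 0) ->
  exists2 t, 0 <= t <= 1 & forall f, L f -> t * c f + (1 - t) * b f <= 0.
Proof.
move=> Lmix bmix cmix cb.
have [c0|] := pselect (forall f, L f -> c f <= 0).
  by exists 1; [lra|move=> f /c0 ?; lra].
move=> /existsNP[f0 /not_implyP[Lf0 /negP]]; rewrite -ltNge => cf0.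
have bf0 := cb _ Lf0 cf0.
have cb0 h : L h -> c h = 0 -> b h <= 0.
  move=> Lh ch; rewrite leNgt; apply/negP => bh.
  (* Mixing in [f0] with this weight makes [c] positive but lowers [b] by less than [b h / 2], so
     [b] would stay positive. *)
  pose t := b h / (2 * (b h - b f0 + 1)).
  have D0 : 0 < 2 * (b h - b f0 + 1) by lra.
  have t0 : 0 < t by rewrite divr_gt0.
  have tD : t * (2 * (b h - b f0 + 1)) = b h by rewrite divfK// gt_eqF.
  have t1 : t < 1 by rewrite ltr_pdivrMr// mul1r; lra.
  have := cb (mix t f0 h) (Lmix _ _ _ _ Lf0 Lh); rewrite cmix bmix ch.
  have : 0 < t * c f0 by rewrite mulr_gt0.
  by move=> ? /(_ ltac:(lra) ltac:(lra)); lra.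
have cross f g : L f -> L g -> 0 < c f -> c g < 0 -> b g * c f <= b f * c g.
  move=> Lf Lg cf cg; have D0 : 0 < c f - c g by lra.
  (* The weight at which [c] vanishes on the mixture of [f] and [g], so that [cb0] applies. *)
  pose t := - c g / (c f - c g).
  have tD : t * (c f - c g) = - c g by rewrite divfK// gt_eqF.
  have t01 : 0 <= t <= 1.
    by rewrite divr_ge0 ?(ltW D0)//=; [rewrite ler_pdivrMr// mul1r|]; lra.
  have tD' : (1 - t) * (c f - c g) = c f by lra.
  have := cb0 (mix t f g) (Lmix _ _ _ t01 Lf Lg); rewrite cmix bmix.
  have E : t * c f + (1 - t) * c g = 0 by lra.
  move=> /(_ E) /(ler_wpM2r (ltW D0)); rewrite mul0r mulrDl.
  by rewrite (mulrAC t) (mulrAC (1 - t)) tD tD'; lra.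
pose S := [set x | exists2 f, L f /\ 0 < c f & x = - b f / c f].
have S0 : lbound S 0.
  by move=> _ [f [Lf cf] ->]; rewrite divr_ge0 ?(ltW cf)// oppr_ge0 cb.
have infS : has_inf S.
  by split; [exists (- b f0 / c f0), f0|exists 0].
pose l := inf S.
have l0 : 0 <= l by apply: lb_le_inf S0; case: infS.
have key f : L f -> l * c f + b f <= 0.
  move=> Lf; have [cf|cf|cf] := ltgtP (c f) 0.
  - have bl : b f / - c f <= l.
      apply: lb_le_inf; first by case: infS.
      move=> _ [g [Lg cg] ->].
      rewrite ler_pdivrMr; last lra.
      rewrite mulrAC ler_pdivlMr//; have := cross _ _ Lg Lf cg cf; lra.
    by move: bl; rewrite ler_pdivrMr; lra.
  - have : l <= - b f / c f by apply: ge_inf; [exists 0|exists f].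
    by rewrite ler_pdivlMr//; lra.
  - by rewrite cf mulr0 add0r; exact: cb0.
have l1 : 0 < l + 1 by lra.
exists (l / (l + 1)).
  by rewrite divr_ge0 ?(ltW l1)//= ler_pdivrMr// mul1r; lra.
move=> f Lf; rewrite -(ler_pM2r l1) mul0r mulrDl mulrAC divfK ?gt_eqF//.
rewrite (mulrAC _ (b f)) mulrBl divfK ?gt_eqF//.
by have := key f Lf; lra.
Qed.

(** Induction on the number of functions. On the convex set where the first function is positive,
    one of the others must be nonpositive, so the induction hypothesis yields weights there. The
    case of two functions then balances the first one against this weighted sum. *)
Lemma minimax (n : nat) (L : set T) (b : 'I_n.+1 -> T -> R) :
  mix_closed L -> (forall i, mix_affine (b i)) ->
  (forall f, L f -> exists i, b i f <= 0) ->
  exists mu : 'I_n.+1 -> R, [/\ forall i, 0 <= mu i, \sum_i mu i = 1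
    & forall f, L f -> \sum_i mu i * b i f <= 0].
Proof.
elim: n L b => [|n IH] L b Lmix bmix Lb.
  exists (fun=> 1); split=> //; first by rewrite big_ord1.
  by move=> f Lf; have [j] := Lb f Lf; rewrite big_ord1 mul1r (ord1 j).
pose L' := [set f | L f /\ 0 < b ord0 f].
have [||f [Lf bf]|mu [mu0 mu1 Lmu]] := IH L' (fun i => b (lift ord0 i)).
- move=> t f g t01 [Lf bf] [Lg bg]; split; first exact: Lmix.
  case/andP: t01 => t0 t1; rewrite bmix.
  have [->|tn0] := eqVneq t 0; first lra.
  by rewrite ltr_wpDr ?mulr_ge0 ?(ltW bg) ?mulr_gt0 ?subr_ge0// lt0r tn0.
- by move=> i; exact: bmix.
- have [i bi] := Lb f Lf; case: (unliftP ord0 i) bi => [j ->|->]; first by exists j.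
  by move=> bi; move: bf; rewrite ltNge bi.
pose c f := \sum_i mu i * b (lift ord0 i) f.
have [||||t t01 Lt] := @minimax2 L c (b ord0).
- exact: Lmix.
- move=> t f g; rewrite /c !mulr_sumr -big_split /=; apply: eq_bigr => i _.
  by rewrite bmix; ring.
- exact: bmix.
- by move=> f Lf bf; exact: Lmu.
exists (fun i => if unlift ord0 i is Some j then (1 - t) * mu j else t).
split=> [i||f Lf].
- by case: unliftP => [j|] _; [rewrite mulr_ge0 ?mu0//; lra|lra].
- rewrite big_ord_recl unlift_none.
  under eq_bigr do rewrite liftK; rewrite -mulr_sumr mu1; lra.
- rewrite big_ord_recl unlift_none.
  under eq_bigr do rewrite liftK -mulrA; rewrite -mulr_sumr.
  exact: Lt.
Qed.

End Minimax.

(** * Closed and open conditions, finite covers and continuous sums *)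

Lemma closed_le_continuous (R : realType) (T : topologicalType) (f : T -> R)
  (c : R) : continuous f -> closed [set t | f t <= c].
Proof.
by move=> cf; apply: (@closed_comp _ _ f [set x | x <= c]) => [t _|];
  [exact: cf|exact: closed_le].
Qed.

Lemma open_lt_continuous (R : realType) (T : topologicalType) (f : T -> R)
  (c : R) : continuous f -> open [set t | f t < c].
Proof.
by move=> cf; apply: (@open_comp _ _ f [set x | x < c]) => [t _|];
  [exact: cf|exact: open_lt].
Qed.

Lemma compact_finite_cover (T : topologicalType) (A : set T) (I : choiceType)
    (f : I -> set T) :
  compact A -> (forall i, open (f i)) -> A `<=` \bigcup_i f i ->
  exists s : seq I, forall x, A x -> exists2 i, i \in s & f i x.
Proof.
have [->|/set0P[x0 _]] := eqVneq A set0; first by exists [::].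
(* [compact_cover] speaks of pointed spaces; a point of the non-empty set serves as base point. *)
pose T' : ptopologicalType := HB.pack_for ptopologicalType T (isPointed.Build T x0).
rewrite -[compact A]/(@compact T' A) compact_cover => cA fo Af.
have [D _ AD] := cA I setT f (fun i _ => fo i) Af.
by exists (finmap.enum_fset D) => x /AD[i iD fx]; exists i.
Qed.

Lemma continuous_subr (R : realType) (T : topologicalType) (f g : T -> R) :
  continuous f -> continuous g -> continuous (fun t => f t - g t).
Proof. by move=> cf cg t; apply: cvgB; [exact: cf|exact: cg]. Qed.

Lemma ptws_eval_continuous (R : realType) (J : choiceType) (p : J) :
  continuous (fun f : {ptws J -> R} => f p).
Proof. exact: (@proj_continuous J (fun=> R) p). Qed.

Lemma continuous_sum (R : realType) (T : topologicalType) (I : Type)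
    (r : seq I) (F : I -> T -> R) :
  (forall i, continuous (F i)) -> continuous (fun t => \sum_(i <- r) F i t).
Proof.
move=> cF; elim: r => [|i r IH].
  rewrite (_ : (fun _ => _) = cst 0); first exact: cst_continuous.
  by apply/funext => t; rewrite big_nil.
rewrite (_ : (fun _ => _) = (fun t => F i t + \sum_(j <- r) F j t)).
  by move=> t; apply: cvgD; [exact: cF|exact: IH].
by apply/funext => t; rewrite big_cons.
Qed.

(** * Almost invariant finite averages on Lipschitz functions *)

Section Folner.
Variables (R : realType) (G : topologicalGroupType).
Hypothesis G_ea : extremely_amenable G.
Variable rho : G -> R.
Hypothesis rhoJ : forall g h, rho (g ^ h)%g = rho g.
Hypothesis rhoV : forall g, rho g^-1%g = rho g.
Hypothesis rho_small : forall e, 0 < e -> \forall g \near 1%g, rho g < e.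

(** Exchanging [a] and [b] gives the opposite bound, since [rho] is invariant under inversion. The
    uniform bound [M] places these functions in a compact cube. *)
Definition rho_lipschitz (M : R) (f : G -> R) :=
  (forall a, `|f a| <= M) /\ forall a b, f b - f a <= rho (a^-1 * b)%g.

Lemma rho_small_at (a : G) e : 0 < e ->
  \forall b \near a, rho (a^-1 * b)%g < e.
Proof.
move=> e0; have ca : (a^-1 * b)%g @[b --> a] --> (a^-1 * a)%g.
  exact: mulg_continuousl.
rewrite mulVg in ca; exact: (ca _ (rho_small e0)).
Qed.

Lemma rho_lipschitz_compact (M : R) (m : nat) :
  compact [set f : {ptws ('I_m * G)%type -> R} |
    forall i, rho_lipschitz M (fun a => f (i, a))].
Proof.
have cK : compact [set f : {ptws ('I_m * G)%type -> R} | forall p, `[-M, M]%classic (f p)].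
  exact: (@tychonoff ('I_m * G)%type (fun=> R) (fun=> `[-M, M]%classic)
    (fun=> @segment_compact R (- M) M)).
apply: (subclosed_compact _ cK); last first.
  move=> f Lf [i a] /=; rewrite in_itv/= -ler_norml.
  by have [] := Lf i.
rewrite (_ : mkset _ =
  \bigcap_i ((\bigcap_a [set f : {ptws ('I_m * G)%type -> R} | `|f (i, a)| <= M]) `&`
   \bigcap_p [set f : {ptws ('I_m * G)%type -> R} | f (i, p.2) - f (i, p.1)
     <= rho (p.1^-1 * p.2)%g])).
  have pc (p : 'I_m * G) := @ptws_eval_continuous R ('I_m * G)%type p.
  apply: closed_bigI => i _; apply: closedI; apply: closed_bigI => a _;
    apply: closed_le_continuous.
    move=> f; apply: (@continuous_comp _ _ _
      (fun f : {ptws ('I_m * G)%type -> R} => f (i, a)) Num.norm).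
      exact: pc.
    exact: norm_continuous.
  by apply: continuous_subr; exact: pc.
apply/seteqP; split=> f /= Lf.
  by move=> i _; have [L1 L2] := Lf i; split=> [a _|p _] /=.
by move=> i; have [L1 L2] := Lf i I; split=> [a|a b]; [exact: L1|exact: (L2 (a, b))].
Qed.

(** If some tuple [f] in [L] had [b x f >= eps] for all [x], the tuples with this property would
    form a compact set stable under right translation; its fixed point is a tuple of constants,
    where [b] vanishes. Hence every tuple is good for some [x], by compactness for some [x] in a
    finite list, and the minimax theorem exchanges the quantifiers at the price of averaging over
    the list. *)
Lemma folner (M : R) (m : nat) (q : 'I_m -> G) (eps : R) : 0 < eps ->
  exists n (x : 'I_n.+1 -> G) (mu : 'I_n.+1 -> R),
  [/\ forall j, 0 <= mu j, \sum_j mu j = 1 &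
   forall f : 'I_m -> G -> R, (forall i, rho_lipschitz M (f i)) ->
   \sum_j mu j * (\sum_i (f i (q i * x j)%g - f i (x j))) <= eps].
Proof.
move=> e0.
pose X := {ptws ('I_m * G)%type -> R}.
pose L := [set f : X | forall i, rho_lipschitz M (fun a => f (i, a))].
pose b (x : G) (f : X) : R := \sum_i (f (i, q i * x)%g - f (i, x)).
have bcont x : continuous (b x).
  apply: (@continuous_sum _ X 'I_m (index_enum _)
    (fun i f => f (i, q i * x)%g - f (i, x))) => i.
  by apply: continuous_subr; exact: ptws_eval_continuous.
have cL : compact L := @rho_lipschitz_compact M m.
have LJ f h : L f -> L (fun p => f (p.1, (p.2 * h)%g)).
  move=> Lf i; have [L1 L2] := Lf i; split=> [a|a c] //=.
  (* Right translation by [h] conjugates [a^-1 * c], which [rho] does not see. *)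
  by apply: le_trans (L2 _ _) _; rewrite -(rhoJ (a^-1 * c)%g h) conjgE invgM !mulgA.
have cover : L `<=` \bigcup_(x in setT) [set f | b x f < eps].
  apply: contrapT => /existsNP[f0 /not_implyP[Lf0 nf0]].
  pose Z := L `&` \bigcap_(x in setT) [set f | - b x f <= - eps].
  have cZ : compact Z.
    apply: compact_closedI => //; apply: closed_bigI => x _.
    by apply: closed_le_continuous => f; exact: (cvgN (bcont x f)).
  have Zf0 : Z f0.
    split=> // x _ /=; rewrite lerN2 leNgt; apply/negP => bx.
    by apply: nf0; exists x.
  have [|||z [Lz Zz] fz] := @ea_fixed_function R G G_ea 'I_m Z cZ.
  - by exists f0.
  - move=> z h [Lz Zz]; split; first exact: LJ.
    move=> x _; have /= := Zz (x * h)%g I; congr (- _ <= _).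
    by apply: eq_bigr => i _; rewrite /= mulgA.
  - move=> i g e ep; near=> h => z [Lz _].
    have [_ L2] := Lz i; rewrite ltr_norml; apply/andP; split.
      rewrite ltrNl opprB; apply: le_lt_trans (L2 _ _) _.
      by rewrite -rhoV invgM invgK; near: h; exact: rho_small_at.
    by apply: le_lt_trans (L2 _ _) _; near: h; exact: rho_small_at.
  have := Zz 1%g I => /=; rewrite /b big1 ?oppr0 ?oppr_ge0 1?leNgt ?e0// => i _.
  by rewrite (fz i (q i * 1)%g 1%g) subrr.
have [D LD] := compact_finite_cover cL
  (fun x => open_lt_continuous eps (bcont x)) cover.
(* The identity is prepended so that the list has [(size D).+1] entries, the form that [minimax]
   expects. *)
pose x i := nth 1%g (1%g :: D) i.
exists (size D), x.
pose mix t (f g : X) : X := fun p => t * f p + (1 - t) * g p.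
have [|||mu [mu0 mu1 Lmu]] := @minimax R X mix (size D) L (fun j f => b (x j) f - eps).
- move=> t f g /andP[t0 t1] Lf Lg i; have [L1 L2] := Lf i; have [L1' L2'] := Lg i.
  have t1' : 0 <= 1 - t by rewrite subr_ge0.
  split=> [a|a c].
    rewrite /mix; apply: le_trans (ler_normD _ _) _.
    rewrite !normrM (ger0_norm t0) (ger0_norm t1').
    by have := ler_wpM2l t0 (L1 a); have := ler_wpM2l t1' (L1' a); lra.
  by have := ler_wpM2l t0 (L2 a c); have := ler_wpM2l t1' (L2' a c); rewrite /mix; lra.
- move=> j t f g; rewrite (_ : b _ (mix t f g) = t * b (x j) f + (1 - t) * b (x j) g).
    by ring.
  by rewrite /b !mulr_sumr -big_split; apply: eq_bigr => i _; rewrite /mix /=; ring.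
- move=> f Lf; have [y yD by_] := LD f Lf.
  have yi : (index y (1%g :: D) < (size D).+1)%N.
    by rewrite -[X in (_ < X)%N]/(size (1%g :: D)) index_mem inE yD orbT.
  exists (Ordinal yi); rewrite /x /= -[if _ then _ else _]/(index y (1%g :: D)).
  by rewrite nth_index ?inE ?yD ?orbT// subr_le0 ltW.
exists mu; split=> // f Lf.
have := Lmu (fun p => f p.1 p.2) Lf.
under eq_bigr do rewrite mulrBr.
by rewrite sumrB -mulr_suml mu1 mul1r subr_le0.
Unshelve. all: by end_near.
Qed.

End Folner.

(** * Almost periodic functions and a discriminant inequality *)

Lemma near_all_seq (T : Type) (I : eqType) (F : set_system T) (FF : Filter F)
    (s : seq I) (P : I -> T -> Prop) :
  (forall i, i \in s -> \forall x \near F, P i x) ->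
  \forall x \near F, forall i, i \in s -> P i x.
Proof.
elim: s => [|i s IH] sP; first by apply: nearW.
apply: filterS2 (sP i _) (IH _) => [x Pi Ps j||j js]; rewrite ?inE ?eqxx//.
  by case/orP => [/eqP ->|/Ps].
by apply: sP; rewrite inE js orbT.
Qed.

Section AlmostPeriodic.
Variables (R : realType) (G : topologicalGroupType).
Hypothesis G_ea : extremely_amenable G.

(** [Z] consists of the uniform limits of right translates of [u]. It is pointwise compact and
    translation invariant, so it contains a constant; this constant is uniformly close to translates
    of [u], hence to [u] itself. *)
Lemma almost_periodic_constant (u : G -> R) (M : R) :
  (forall a, `|u a| <= M) -> continuous u ->
  (forall e, 0 < e -> exists s : seq G, forall g, exists2 h, h \in s &
     forall a, `|u (a * g)%g - u (a * h)%g| <= e) ->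
  forall a b, u a = u b.
Proof.
move=> uM uc uap.
(* The positivity of [e] is moved inside, with [[::]] as default, so that [choice] applies to all
   real [e]. *)
have s_ex (e : R) : exists s : seq G, 0 < e -> forall g,
    exists2 h, h \in s & forall a, `|u (a * g)%g - u (a * h)%g| <= e.
  have [/uap[s sP]|e0] := pselect (0 < e); first by exists s.
  by exists [::].
have [s sP] := choice s_ex.
pose X := {ptws (unit * G)%type -> R}.
pose close (y : X) g e := forall a, `|y (tt, a) - u (a * g)%g| <= e.
pose Z := [set y : X | forall e, 0 < e -> exists g, close y g e].
(* Replacing an arbitrary translate by one from the net doubles the error but leaves a finite union
   of closed conditions for each [e]; this is what makes [Z] closed. *)
have ZE : Z = \bigcap_(e in [set e : R | 0 < e])
    \bigcup_(h in [set` s e]) [set y | close y h (e + e)].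
  apply/seteqP; split=> y.
    move=> Zy e /= e0; have [g yg] := Zy e e0; have [h hs gh] := sP e e0 g.
    exists h => //= a; rewrite -(subrKA (u (a * g)%g)).
    by apply: le_trans (ler_normD _ _) _; apply: lerD; [exact: yg|exact: gh].
  move=> Zy e e0; have e20 : 0 < e / 2 by rewrite divr_gt0.
  by have [h _ /=] := Zy (e / 2) e20; rewrite -splitr => yh; exists h.
have pc (p : unit * G) := @ptws_eval_continuous R (unit * G)%type p.
have cZ : compact Z.
  have cK : compact [set f : X | forall p, `[- (M + 1), M + 1]%classic (f p)].
    exact: (@tychonoff (unit * G)%type (fun=> R) (fun=> `[- (M + 1), M + 1]%classic)
      (fun=> @segment_compact R (- (M + 1)) (M + 1))).
  apply: (subclosed_compact _ cK); last first.
    move=> y Zy [[] a] /=; have [g yg] := Zy 1 ltr01.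
    rewrite in_itv/= -ler_norml -(subrK (u (a * g)%g) (y (tt, a))) addrC.
    by apply: le_trans (ler_normD _ _) _; apply: lerD; [exact: uM|exact: yg].
  rewrite ZE; apply: closed_bigI => e e0.
  apply: closed_bigcup => [|h _]; first exact: finite_seq.
  rewrite (_ : mkset _ = \bigcap_a [set y : X | `|y (tt, a) - u (a * h)%g| <= e + e]).
    apply: closed_bigI => a _; apply: closed_le_continuous => y.
    apply: (@continuous_comp _ _ _ (fun y : X => y (tt, a) - u (a * h)%g) Num.norm).
      by apply: continuous_subr; [exact: pc|exact: cst_continuous].
    exact: norm_continuous.
  by apply/seteqP; split=> y /= yh a; [move=> _; exact: yh|exact: (yh a)].
have [|z h Zz|i g e e0|y Zy fy] := @ea_fixed_function R G G_ea unit Z cZ.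
- exists (fun p => u p.2) => e e0; exists 1%g => a /=.
  by rewrite mulg1 subrr normr0 ltW.
- move=> e e0; have [g zg] := Zz e e0; exists (h * g)%g => a /=.
  by rewrite mulgA; exact: zg.
(* Passing from [y] to a net translate costs [e / 3] at each of the two points, and moving the point
   costs less than [e / 6]: together less than [e]. *)
- have e50 : 0 < e / 6 by rewrite divr_gt0.
  have : \forall x \near g, forall k, k \in s (e / 6) ->
      `|u (x * k)%g - u (g * k)%g| < e / 6.
    apply: near_all_seq => k _.
    have /cvgrPdist_lt /(_ _ e50) : u (x * k)%g @[x --> g] --> u (g * k)%g.
      apply: (@continuous_comp _ _ _ (fun x => (x * k)%g) u).
        exact: mulg_continuousr.
      exact: uc.
    by apply: filterS => x; rewrite distrC.
  apply: filterS => x us y; rewrite {1}ZE => /(_ _ e50)[k /= ks yk].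
  have := yk x; have := yk g; have := us k ks; case: i.
  by rewrite !ltr_norml !ler_norml => /andP[? ?] /andP[? ?] /andP[? ?]; lra.
have yu e : 0 < e -> forall a, `|y (tt, 1%g) - u a| <= e.
  move=> e0 a; have [g yg] := Zy e e0.
  by have := yg (a * g^-1)%g; rewrite -mulgA mulVg mulg1 (fy tt _ 1%g).
have E a : y (tt, 1%g) = u a.
  apply/eqP; rewrite -subr_eq0 -normr_le0; apply/ler_addgt0Pr => e e0.
  by rewrite add0r; exact: yu.
by move=> a b; rewrite -!E.
Qed.

End AlmostPeriodic.

(** The optimal choice is [t = b / c]; for [c = 0] a nonzero [b] would make the left side unbounded.
    Every Cauchy-Schwarz inequality below comes from this one. *)
Lemma real_quadratic_le (R : realType) (a b c : R) : 0 <= c ->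
  (forall t, 2 * t * b - t ^+ 2 * c <= a) -> b ^+ 2 <= a * c.
Proof.
rewrite le_eqVlt => /orP[/eqP<-|c0] H.
  have [->|b0] := eqVneq b 0; first by rewrite expr0n mulr0.
  have := H ((a + 1) / (2 * b)); rewrite mulr0 subr0 mulrAC mulrA.
  by rewrite [_ * (a + 1)]mulrC mulfK ?mulf_neq0// ?pnatr_eq0//; lra.
have := H (b / c); rewrite -(ler_pM2r c0).
have -> : (2 * (b / c) * b - (b / c) ^+ 2 * c) * c = b ^+ 2.
  by field; rewrite gt_eqF.
by [].
Qed.

(** * Inner products from the parallelogram identity *)

Section JordanVonNeumann.
Variables (R : realType) (V : lmodType R[i]) (N : V -> R).
Hypothesis N_ge0 : forall x, 0 <= N x.
Hypothesis NZ : forall (a : R[i]) x,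
  N (a *: x) = (complex.Re a ^+ 2 + complex.Im a ^+ 2) * N x.
Hypothesis parallelogram : forall x y, N (x + y) + N (x - y) = 2 * (N x + N y).

(** The real part of the inner product to be built, where [N] is the squared norm. *)
Definition polar x y : R := (N (x + y) - N (x - y)) / 4.

Let NN x : N (- x) = N x.
Proof. by rewrite -scaleN1r NZ /= oppr0 sqrrN expr1n expr0n addr0 mul1r. Qed.

Let N00 : N 0 = 0.
Proof. by rewrite -(scale0r 0) NZ /= expr0n addr0 mul0r. Qed.

Lemma polarC x y : polar x y = polar y x.
Proof. by rewrite /polar (addrC y) -[N (y - x)]NN opprB. Qed.

(** A linear combination of four instances of the parallelogram identity, once the six distinct
    vectors in them are matched up to sign. *)
Lemma polarDl x y z : polar (x + y) z = polar x z + polar y z.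
Proof.
have p1 := parallelogram (x + z) y; have p2 := parallelogram (y + z) x.
have p3 := parallelogram (x - z) y; have p4 := parallelogram (y - z) x.
have e1 : x + z + y = x + y + z by rewrite addrAC.
have e2 : y + z + x = x + y + z by rewrite addrAC (addrC y).
have e3 : x - z + y = x + y - z by rewrite addrAC.
have e4 : y - z + x = x + y - z by rewrite addrAC (addrC y).
have e5 : N (x - z - y) = N (y + z - x).
  by rewrite -[N (x - z - y)]NN !opprB addrA.
have e6 : N (y - z - x) = N (x + z - y).
  by rewrite -[N (y - z - x)]NN !opprB addrA.
rewrite e1 in p1; rewrite e2 in p2; rewrite e3 e5 in p3; rewrite e4 e6 in p4.
by rewrite /polar; lra.
Qed.

Lemma polar0l y : polar 0 y = 0.
Proof. by rewrite /polar add0r sub0r NN subrr mul0r. Qed.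

Lemma polarNl x y : polar (- x) y = - polar x y.
Proof. by apply/eqP; rewrite -addr_eq0 -polarDl addNr polar0l. Qed.

(* An additive function bounded on [0, 1] and vanishing at 1 is zero. *)
Lemma polarZl (t : R) x y : polar (t%:C *: x) y = t * polar x y.
Proof.
pose phi t := polar (t%:C *: x) y - t * polar x y.
have phiD s u : phi (s + u) = phi s + phi u.
  by rewrite /phi rmorphD /= scalerDl polarDl; lra.
have phiN s : phi (- s) = - phi s.
  by rewrite /phi rmorphN /= scaleNr polarNl; lra.
have phi1 : phi 1 = 0 by rewrite /phi scale1r mul1r subrr.
have phin n s : phi (n%:R * s) = n%:R * phi s.
  elim: n => [|n IH]; first by rewrite !mul0r /phi scale0r polar0l; lra.
  by rewrite -natr1 !mulrDl phiD IH !mul1r.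
pose B := (N x + N y) / 2 + `|polar x y|.
have phiB1 s : 0 <= s <= 1 -> `|phi s| <= B.
  move=> s01; apply: le_trans (ler_normB _ _) _; apply: lerD; last first.
    rewrite normrM ger0_norm; last by case/andP: s01.
    by rewrite ler_piMl//; case/andP: s01.
  have p := parallelogram (s%:C *: x) y; rewrite NZ /= expr0n addr0 in p.
  have s2 : s ^+ 2 * N x <= N x.
    by rewrite ler_piMl// expr_le1//; case/andP: s01.
  have h1 := N_ge0 (s%:C *: x + y); have h2 := N_ge0 (s%:C *: x - y).
  by rewrite /polar ler_norml; apply/andP; split; lra.
(* [phi] vanishes at the natural numbers, so the bound on [[0, 1]] extends to the half line by
   removing the integer part. *)
have phiBp s : 0 <= s -> `|phi s| <= B.
  move=> s0; have /andP[n1 n2] := truncn_itv s0.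
  set n := Num.truncn s in n1 n2.
  have -> : s = (s - n%:R) + n%:R * 1 by rewrite mulr1 subrK.
  rewrite phiD phin phi1 mulr0 addr0; apply: phiB1.
  by move: n2; rewrite -natr1; lra.
have phiB s : `|phi s| <= B.
  have [/phiBp//|/ltW s0] := leP 0 s.
  by rewrite -normrN -phiN; apply: phiBp; rewrite oppr_ge0.
apply/eqP; rewrite -subr_eq0 -/(phi t) -normr_eq0 eq_le normr_ge0 andbT leNgt.
apply/negP => p0; have := phiB ((Num.truncn (B / `|phi t|)).+1%:R * t).
rewrite phin normrM ger0_norm// -ler_pdivlMr//.
by rewrite leNgt truncnS_gt.
Qed.

Lemma polarxx x : polar x x = N x.
Proof.
have -> : polar x x = N (2%:R *: x) / 4.
  by rewrite /polar subrr N00 subr0 scaler_nat.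
by rewrite NZ /= addr0 expr0n addr0; field.
Qed.

Lemma normD x y : N (x + y) = N x + N y + 2 * polar x y.
Proof. by have := parallelogram x y; rewrite /polar; lra. Qed.

Lemma polar_cauchy_schwarz x y : polar x y ^+ 2 <= N x * N y.
Proof.
apply: real_quadratic_le => // t.
have := N_ge0 (x + (- t)%:C *: y).
rewrite normD polarC polarZl polarC NZ /= expr0n addr0 sqrrN; lra.
Qed.

Lemma sqrt_norm_triangle x y :
  Num.sqrt (N (x + y)) <= Num.sqrt (N x) + Num.sqrt (N y).
Proof.
rewrite -(@ler_pXn2r _ 2) ?nnegrE ?addr_ge0 ?sqrtr_ge0//.
rewrite sqr_sqrtr// normD sqrrD !sqr_sqrtr// -addrA (addrC (N y)) addrA lerD2r.
rewrite lerD2l -sqrtrM// mulr_natl lerMn2r/=.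
apply: le_trans (ler_norm _) _.
by rewrite -sqrtr_sqr ler_sqrt ?mulr_ge0//; exact: polar_cauchy_schwarz.
Qed.

Lemma polar_iNl x y : polar ('i *: x) y = - polar x ('i *: y).
Proof.
have ii u v : polar ('i *: u) ('i *: v) = polar u v.
  by rewrite /polar -scalerDr -scalerBr !NZ /= expr0n expr1n add0r !mul1r.
have -> : y = 'i *: (- ('i *: y)).
  by rewrite scalerN scalerA -expr2 sqr_i scaleN1r opprK.
by rewrite ii polarC polarNl polarC scalerN scalerA -expr2 sqr_i scaleN1r opprK.
Qed.

(** Antilinearity in the second variable forces the imaginary part to be the real part of the
    product of [x] with ['i *: y]. *)
Definition jvn_dot x y : R[i] := polar x y +i* polar x ('i *: y).

Lemma jvn_dot_linear y : linear_for *%R (jvn_dot^~ y).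
Proof.
move=> a x z; rewrite /jvn_dot.
have pa w : polar (a *: x) w =
    complex.Re a * polar x w - complex.Im a * polar x ('i *: w).
  have -> : a *: x = (complex.Re a)%:C *: x + (complex.Im a)%:C *: ('i *: x).
    by rewrite scalerA -scalerDl mulrC -complexE.
  by rewrite polarDl !polarZl polar_iNl; lra.
have pi : polar x ('i *: ('i *: y)) = - polar x y.
  by rewrite scalerA -expr2 sqr_i scaleN1r polarC polarNl polarC.
case: a pa => a b /= pa; rewrite !polarDl !pa pi.
by apply/eqP; rewrite eq_complex /=; apply/andP; split; apply/eqP; lra.
Qed.

Lemma jvn_dot_hermitian x y : jvn_dot x y = Num.conj (jvn_dot y x).
Proof.
rewrite /jvn_dot polarC; apply/eqP; rewrite eq_complex /= eqxx /=.
by rewrite -polar_iNl polarC.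
Qed.

Lemma jvn_dotxx x : jvn_dot x x = (N x)%:C.
Proof.
rewrite /jvn_dot polarxx; apply/eqP; rewrite eq_complex /= eqxx /=.
by have := polar_iNl x x; rewrite polarC => /eqP; rewrite -addr_eq0 -mulr2n mulrn_eq0.
Qed.

End JordanVonNeumann.

(** * Reproducing kernel Hilbert spaces *)

(** Positivity is asked of the real part only, the double sum being real by Hermitian symmetry. *)
Record psd_kernel (R : realType) (X : Type) := PsdKernel {
  kernel_fun :> X -> X -> R[i] ;
  kernel_hermitian : forall x y, kernel_fun y x = Num.conj (kernel_fun x y) ;
  kernel_psd : forall s : seq (R[i] * X),
    0 <= complex.Re (\sum_(p <- s) \sum_(r <- s)
           p.1 * Num.conj r.1 * kernel_fun p.2 r.2)
}.

Section Rkhs.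
Variables (R : realType) (X : Type) (K : psd_kernel R X).
Implicit Types (s t : seq (R[i] * X)) (f g : X -> R[i]).

(** By the reproducing property this is the inner product of [f] with [kernel_comb s], available
    before any inner product has been constructed. *)
Definition pairing f s : R[i] := \sum_(p <- s) Num.conj p.1 * f p.2.

Definition kernel_comb s : X -> R[i] := fun y => \sum_(p <- s) p.1 * K p.2 y.

Definition comb_sqnorm s : R := complex.Re (pairing (kernel_comb s) s).

Definition scale_comb (a : R[i]) s := [seq (a * p.1, p.2) | p <- s].

(* The squared norm of the functional [pairing f] is the supremum of [rkhs_gap f],
   which makes the parallelogram identity a change of variables. *)
Definition rkhs_gap f s : R := 2 * complex.Re (pairing f s) - comb_sqnorm s.

Lemma pairing_cat f s t : pairing f (s ++ t) = pairing f s + pairing f t.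
Proof. exact: big_cat. Qed.

Lemma pairing_scale f a s : pairing f (scale_comb a s) = Num.conj a * pairing f s.
Proof.
rewrite /pairing big_map mulr_sumr; apply: eq_bigr => p _ /=.
by rewrite rmorphM mulrA.
Qed.

Lemma pairingD f g s : pairing (f + g) s = pairing f s + pairing g s.
Proof. by rewrite -big_split; apply: eq_bigr => p _; rewrite /= -mulrDr. Qed.

Lemma pairingZ a f s : pairing (a *: f) s = a * pairing f s.
Proof. by rewrite mulr_sumr; apply: eq_bigr => p _; rewrite mulrCA. Qed.

Lemma pairingN f s : pairing (- f) s = - pairing f s.
Proof. by rewrite -scaleN1r pairingZ mulN1r. Qed.

Lemma pairing1 f a x : pairing f [:: (a, x)] = Num.conj a * f x.
Proof. exact: big_seq1. Qed.

Lemma kernel_comb_cat s t : kernel_comb (s ++ t) = kernel_comb s + kernel_comb t.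
Proof. by apply/funext => y; exact: big_cat. Qed.

Lemma kernel_comb_scale a s : kernel_comb (scale_comb a s) = a *: kernel_comb s.
Proof.
apply/funext => y; rewrite /kernel_comb big_map [RHS]mulr_sumr.
by apply: eq_bigr => p _ /=; rewrite mulrA.
Qed.

Lemma pairing_kernel_comb s t : pairing (kernel_comb s) t =
  \sum_(p <- s) \sum_(r <- t) p.1 * Num.conj r.1 * K p.2 r.2.
Proof.
rewrite exchange_big; apply: eq_bigr => p _; rewrite mulr_sumr.
by apply: eq_bigr => r _; rewrite mulrCA mulrA.
Qed.

Lemma pairing_kernel_combC s t :
  pairing (kernel_comb t) s = Num.conj (pairing (kernel_comb s) t).
Proof.
rewrite !pairing_kernel_comb rmorph_sum exchange_big /=.
apply: eq_bigr => p _; rewrite rmorph_sum; apply: eq_bigr => r _ /=.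
by rewrite !rmorphM /= -kernel_hermitian conjCK (mulrC p.1^*).
Qed.

Lemma comb_sqnorm_ge0 s : 0 <= comb_sqnorm s.
Proof. by rewrite /comb_sqnorm pairing_kernel_comb; exact: kernel_psd. Qed.

Lemma pairing_kernel_combxx s :
  pairing (kernel_comb s) s = (comb_sqnorm s)%:C.
Proof.
have := pairing_kernel_combC s s; rewrite /comb_sqnorm.
case: (pairing _ _) => a b /eqP; rewrite eq_complex /= eqxx /= => /eqP bb.
by apply/eqP; rewrite eq_complex /= eqxx /=; apply/eqP; lra.
Qed.

Lemma comb_sqnorm_cat s t : comb_sqnorm (s ++ t) =
  comb_sqnorm s + comb_sqnorm t + 2 * complex.Re (pairing (kernel_comb s) t).
Proof.
rewrite /comb_sqnorm pairing_cat !kernel_comb_cat !pairingD.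
rewrite (pairing_kernel_combC s t) !raddfD /=.
by case: (pairing (kernel_comb s) t) => a b /=; lra.
Qed.

Lemma comb_sqnorm_scale a s : comb_sqnorm (scale_comb a s) =
  (complex.Re a ^+ 2 + complex.Im a ^+ 2) * comb_sqnorm s.
Proof.
rewrite /comb_sqnorm kernel_comb_scale pairingZ pairing_scale.
rewrite pairing_kernel_combxx; case: a => a b /=; ring.
Qed.

Lemma Re_pairing_scale_real f (a : R) s :
  complex.Re (pairing f (scale_comb a%:C s)) = a * complex.Re (pairing f s).
Proof. by rewrite pairing_scale; case: (pairing f s) => ? ? /=; ring. Qed.

Lemma comb_sqnorm_scale_real (a : R) s :
  comb_sqnorm (scale_comb a%:C s) = a ^+ 2 * comb_sqnorm s.
Proof. by rewrite comb_sqnorm_scale /= expr0n addr0. Qed.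

Definition rkhs_bounded f (M : R) := forall s, rkhs_gap f s <= M.

(** Halving the test combination gives an exact identity: the gap of [f + g] at [s] is twice the sum
    of the gaps of [f] and [g] at [s / 2]. *)
Lemma rkhs_boundedD f g M M' : rkhs_bounded f M -> rkhs_bounded g M' ->
  rkhs_bounded (f + g) (2 * M + 2 * M').
Proof.
move=> fM gM s; have := fM (scale_comb (2^-1)%:C s).
have := gM (scale_comb (2^-1)%:C s).
by rewrite /rkhs_gap !Re_pairing_scale_real comb_sqnorm_scale_real pairingD raddfD /=; lra.
Qed.

Lemma rkhs_gapZ (a : R[i]) f s : a != 0 -> rkhs_gap (a *: f) s =
  (complex.Re a ^+ 2 + complex.Im a ^+ 2) * rkhs_gap f (scale_comb a^-1 s).
Proof.
move=> a0; rewrite /rkhs_gap comb_sqnorm_scale pairing_scale pairingZ.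
case: a a0 (pairing f s) => a b; rewrite eq_complex /= negb_and => ab [c d] /=.
have ab0 : a ^+ 2 + b ^+ 2 != 0.
  rewrite paddr_eq0 ?sqr_ge0// !sqrf_eq0 negb_and.
  by case/orP: ab => ->; rewrite ?orbT.
by field.
Qed.

Lemma rkhs_boundedZ (a : R[i]) f M : rkhs_bounded f M ->
  rkhs_bounded (a *: f) ((complex.Re a ^+ 2 + complex.Im a ^+ 2) * M).
Proof.
move=> fM s; have [->|a0] := eqVneq a 0.
  rewrite scale0r /= expr0n addr0 mul0r /rkhs_gap.
  rewrite (_ : pairing 0 s = 0); last first.
    by rewrite /pairing big1// => p _; rewrite mulr0.
  by rewrite mulr0 sub0r oppr_le0 comb_sqnorm_ge0.
rewrite rkhs_gapZ//; apply: ler_wpM2l => //.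
by rewrite addr_ge0// sqr_ge0.
Qed.

(** With [k = kernel_comb s], completing the square gives [2 Re <f, k> - |k|^2 = |f|^2 - |f - k|^2].
    Bounded gaps thus single out the functions of finite norm. *)
Definition rkhs_pred : {pred X -> R[i]} :=
  fun f => `[< exists M, rkhs_bounded f M >].

Lemma rkhs_pred_submod : submod_closed rkhs_pred.
Proof.
split.
  apply/asboolP; exists 0 => s; rewrite /rkhs_gap /pairing big1 => [|p _].
    by rewrite mulr0 sub0r oppr_le0 comb_sqnorm_ge0.
  by rewrite mulr0.
move=> a f g /asboolP[M fM] /asboolP[M' gM]; apply/asboolP.
by eexists; apply: rkhs_boundedD; [apply: rkhs_boundedZ|]; eassumption.
Qed.

HB.instance Definition _ := GRing.isSubmodClosed.Build R[i] (X -> R[i])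
  rkhs_pred rkhs_pred_submod.

Record rkhs := Rkhs { rkhs_fun :> X -> R[i] ; rkhs_funP : rkhs_fun \in rkhs_pred }.

HB.instance Definition _ := [isSub for rkhs_fun].
HB.instance Definition _ := [Choice of rkhs by <:].
HB.instance Definition _ := [SubChoice_isSubLmodule of rkhs by <:].

Lemma rkhs_funD (f g : rkhs) : (f + g : rkhs) = (f : X -> R[i]) + g :> (X -> R[i]).
Proof. by []. Qed.

Lemma rkhs_funN (f : rkhs) : (- f : rkhs) = - (f : X -> R[i]) :> (X -> R[i]).
Proof. by []. Qed.

Lemma rkhs_ext (f g : rkhs) : f =1 g -> f = g.
Proof. by move=> fg; apply: val_inj; apply/funext. Qed.

Definition rkhs_sqnorm (f : rkhs) : R := sup (range (rkhs_gap f)).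

Lemma rkhs_has_sup (f : rkhs) : has_sup (range (rkhs_gap f)).
Proof.
have /asboolP[M fM] := rkhs_funP f; split; first by exists (rkhs_gap f [::]), [::].
by exists M => _ [s _ <-].
Qed.

Lemma rkhs_gap_le (f : rkhs) s : rkhs_gap f s <= rkhs_sqnorm f.
Proof. by apply: ub_le_sup; [case: (rkhs_has_sup f)|exists s]. Qed.

Lemma rkhs_sqnorm_le (f : rkhs) M : rkhs_bounded f M -> rkhs_sqnorm f <= M.
Proof.
by move=> fM; apply: ge_sup; [case: (rkhs_has_sup f)|move=> _ [s _ <-]].
Qed.

Lemma rkhs_sqnorm_adherent (f : rkhs) e : 0 < e ->
  exists s, rkhs_sqnorm f - e < rkhs_gap f s.
Proof.
move=> e0; have [_ [s _ <-] ?] := sup_adherent e0 (rkhs_has_sup f).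
by exists s.
Qed.

Lemma rkhs_sqnorm_ge0 (f : rkhs) : 0 <= rkhs_sqnorm f.
Proof.
apply: le_trans (rkhs_gap_le f [::]).
by rewrite /rkhs_gap /comb_sqnorm /pairing !big_nil mulr0 subrr.
Qed.

Lemma rkhs_sqnormZ (a : R[i]) (f : rkhs) : rkhs_sqnorm (a *: f) =
  (complex.Re a ^+ 2 + complex.Im a ^+ 2) * rkhs_sqnorm f.
Proof.
have le (b : R[i]) (g : rkhs) : rkhs_sqnorm (b *: g) <=
    (complex.Re b ^+ 2 + complex.Im b ^+ 2) * rkhs_sqnorm g.
  by apply: rkhs_sqnorm_le; apply: rkhs_boundedZ => s; exact: rkhs_gap_le.
apply/eqP; rewrite eq_le le /=.
have [->|a0] := eqVneq a 0; first by rewrite /= expr0n addr0 mul0r rkhs_sqnorm_ge0.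
have := le a^-1 (a *: f); rewrite scalerA mulVf// scale1r.
case: a a0 => a b; rewrite eq_complex /= negb_and => ab.
have ab0 : 0 < a ^+ 2 + b ^+ 2.
  rewrite lt0r addr_ge0 ?sqr_ge0// andbT.
  rewrite paddr_eq0 ?sqr_ge0// !sqrf_eq0 negb_and.
  by case/orP: ab => ->; rewrite ?orbT.
rewrite -(ler_pM2l ab0) => /le_trans; apply.
rewrite le_eqVlt; apply/orP; left; apply/eqP; field.
by rewrite gt_eqF.
Qed.

(** If [s] and [t] are nearly optimal for [u + v] and [u - v], testing [u] on [(s + t) / 2] and [v]
    on [(s - t) / 2] yields one inequality. Applied to [f + g] and [f - g] it yields the other. *)
Lemma rkhs_parallelogram (f g : rkhs) :
  rkhs_sqnorm (f + g) + rkhs_sqnorm (f - g) = 2 * (rkhs_sqnorm f + rkhs_sqnorm g).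
Proof.
have le (u v : rkhs) : rkhs_sqnorm (u + v) + rkhs_sqnorm (u - v) <=
    2 * (rkhs_sqnorm u + rkhs_sqnorm v).
  apply/ler_addgt0Pr => e e0; have e20 : 0 < e / 2 by rewrite divr_gt0.
  have [s hs] := rkhs_sqnorm_adherent (u + v) e20.
  have [t ht] := rkhs_sqnorm_adherent (u - v) e20.
  have := rkhs_gap_le u (scale_comb (2^-1)%:C (s ++ t)).
  have := rkhs_gap_le v (scale_comb (2^-1)%:C (s ++ scale_comb (- 1)%:C t)).
  move: hs ht; rewrite /rkhs_gap rkhs_funD rkhs_funD rkhs_funN !pairingD !pairingN.
  rewrite !Re_pairing_scale_real !comb_sqnorm_scale_real.
  rewrite !comb_sqnorm_cat !pairing_cat !raddfD /= !Re_pairing_scale_real.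
  rewrite comb_sqnorm_scale_real.
  by rewrite ?raddfD ?raddfN /=; lra.
apply/eqP; rewrite eq_le le /=.
have := le (f + g) (f - g).
have -> : f + g + (f - g) = 2%:R *: f by rewrite addrACA subrr addr0 scaler_nat.
have -> : f + g - (f - g) = 2%:R *: g.
  by rewrite opprB (addrC f) addrACA subrr addr0 scaler_nat.
by rewrite !rkhs_sqnormZ /= addr0 expr0n addr0; lra.
Qed.

End Rkhs.

(** * Evaluation bounds, completeness and the Hilbert space structure *)

Section RkhsHilbert.
Variables (R : realType) (X : Type) (K : psd_kernel R X).
Local Notation E := (rkhs K).

Lemma pairing_cauchy_schwarz (f : E) s :
  complex.Re (pairing f s) ^+ 2 <= rkhs_sqnorm f * comb_sqnorm K s.
Proof.
apply: real_quadratic_le => [|t]; first exact: comb_sqnorm_ge0.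
have := rkhs_gap_le f (scale_comb t%:C s).
by rewrite /rkhs_gap Re_pairing_scale_real comb_sqnorm_scale_real mulrA.
Qed.

(** Cauchy-Schwarz against a single kernel function. The coefficient [f x] rotates the value at [x]
    so that its real part becomes the squared modulus. *)
Lemma rkhs_eval_le (f : E) x :
  complex.Re (f x) ^+ 2 + complex.Im (f x) ^+ 2
    <= rkhs_sqnorm f * complex.Re (K x x).
Proof.
have := pairing_cauchy_schwarz f [:: (f x, x)].
rewrite pairing1 /comb_sqnorm pairing1 /kernel_comb big_seq1 /=.
set k := complex.Re (K x x); case: (f x) => a b /=.
set n := rkhs_sqnorm f; set A := a ^+ 2 + b ^+ 2.
have -> : a * a - - b * b = A by rewrite /A; ring.
have Kim : complex.Im (K x x) = 0.
  have := kernel_hermitian K x x; case: (K x x) => u v /= /eqP.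
  by rewrite eq_complex /= eqxx /= => /eqP; lra.
have -> : complex.Re (((a +i* b)^*)%R * ((a +i* b) * K x x)) = A * k.
  by rewrite /A /k; case: (K x x) Kim => u v /= ->; ring.
have A0 : 0 <= A by rewrite addr_ge0// sqr_ge0.
have [->|An0] := eqVneq A 0.
  move=> _; rewrite mulr_ge0 ?rkhs_sqnorm_ge0//.
  have := comb_sqnorm_ge0 K [:: (1, x)].
  by rewrite /comb_sqnorm pairing1 /kernel_comb big_seq1 /= !rmorph1 !mul1r.
have Ap : 0 < A by rewrite lt0r An0.
by rewrite expr2 mulrCA ler_pM2l.
Qed.

Lemma rkhs_sqnorm_eq0 (f : E) : rkhs_sqnorm f = 0 -> f = 0.
Proof.
move=> f0; apply: rkhs_ext => x; have := rkhs_eval_le f x; rewrite f0 mul0r.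
case: (f x) => a b /= ab; have a2 := sqr_ge0 a; have b2 := sqr_ge0 b.
have a0 : a ^+ 2 == 0 by rewrite eq_le a2 andbT; lra.
have b0 : b ^+ 2 == 0 by rewrite eq_le b2 andbT; lra.
by move: a0 b0; rewrite !sqrf_eq0 => /eqP -> /eqP ->.
Qed.

Definition rkhs_norm (f : E) : R[i] := (Num.sqrt (rkhs_sqnorm f))%:C.

Lemma rkhs_norm_triangle (f g : E) :
  rkhs_norm (f + g) <= rkhs_norm f + rkhs_norm g.
Proof.
rewrite /rkhs_norm -rmorphD /= lecR; apply: sqrt_norm_triangle.
- exact: rkhs_sqnorm_ge0.
- exact: rkhs_sqnormZ.
- exact: rkhs_parallelogram.
Qed.

Lemma rkhs_normZ (a : R[i]) (f : E) : rkhs_norm (a *: f) = `|a| * rkhs_norm f.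
Proof.
rewrite /rkhs_norm rkhs_sqnormZ sqrtrM ?addr_ge0 ?sqr_ge0//.
by rewrite normc_def rmorphM.
Qed.

Lemma rkhs_norm_eq0 (f : E) : rkhs_norm f = 0 -> f = 0.
Proof.
move=> /complexI /eqP; rewrite sqrtr_eq0 => f0; apply: rkhs_sqnorm_eq0.
by apply/eqP; rewrite eq_le f0 rkhs_sqnorm_ge0.
Qed.

HB.instance Definition _ := Lmodule_isNormed.Build R[i] E
  rkhs_norm_triangle rkhs_normZ rkhs_norm_eq0.

Lemma rkhs_normE (f : E) : `|f| = (Num.sqrt (rkhs_sqnorm f))%:C.
Proof. by []. Qed.

Lemma rkhs_norm_lt (f : E) (e : R) : 0 < e ->
  (`|f| < e%:C) = (rkhs_sqnorm f < e ^+ 2).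
Proof.
move=> e0; rewrite rkhs_normE ltcR -(@ltr_pXn2r _ 2) ?nnegrE ?sqrtr_ge0 ?(ltW e0)//.
by rewrite sqr_sqrtr// rkhs_sqnorm_ge0.
Qed.

Lemma gt0_complex (e : R[i]) : 0 < e -> exists2 r : R, 0 < r & e = r%:C.
Proof.
case: e => a b; rewrite ltcE /= => /andP[/eqP b0 a0].
by exists a => //; rewrite b0.
Qed.

Lemma rkhs_cauchy (F : set_system E) : ProperFilter F -> cauchy F ->
  forall e : R, 0 < e -> exists2 A : set E, F A &
    forall f g, A f -> A g -> rkhs_sqnorm (f - g) < e.
Proof.
move=> FF /cauchy_ballP Fc e e0.
have se0 : 0 < Num.sqrt e by rewrite sqrtr_gt0.
have [|[A B] /= [FA FB] AB] := Fc (Num.sqrt e)%:C; first by rewrite ltcR.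
exists (A `&` B); first exact: filterI.
move=> f g [Af Bf] [Ag Bg]; have := AB (f, g) (conj Af Bg).
by rewrite /= -ball_normE /= rkhs_norm_lt// sqr_sqrtr// ltW.
Qed.

(** Pairings with a fixed combination converge along a Cauchy filter. Their limits are the pairings
    of one function [L], and bounds on gaps pass to the limit, which gives both membership of [L]
    and convergence in norm. *)
Lemma rkhs_complete (F : set_system E) : ProperFilter F -> cauchy F -> cvg F.
Proof.
move=> FF Fc.
have evc s : cvg ((fun f : E => complex.Re (pairing f s)) @ F).
  apply: R_complete; apply: cauchy_exP => e e0.
  pose c := comb_sqnorm K s + 1.
  have c0 : 0 < c by rewrite /c ltr_wpDl// comb_sqnorm_ge0.
  have [|A FA Ad] := rkhs_cauchy FF Fc (e := e ^+ 2 / c).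
    by rewrite divr_gt0// exprn_gt0.
  have [f0 Af0] := filter_ex FA.
  exists (complex.Re (pairing f0 s)).
  suff : F [set f : E | ball (complex.Re (pairing f0 s)) e (complex.Re (pairing f s))] by [].
  apply: filterS FA => f Af /=.
  rewrite -ball_normE /=.
  have -> : complex.Re (pairing f0 s) - complex.Re (pairing f s) =
      complex.Re (pairing (f0 - f : E) s).
    by rewrite rkhs_funD rkhs_funN pairingD pairingN raddfB.
  rewrite -(@ltr_pXn2r _ 2) ?nnegrE ?(ltW e0)// real_normK ?num_real//.
  apply: le_lt_trans (pairing_cauchy_schwarz _ _) _.
  have := Ad _ _ Af0 Af; rewrite ltr_pdivlMr// => /(le_lt_trans _); apply.
  by rewrite ler_wpM2l ?rkhs_sqnorm_ge0// /c lerDl.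
pose l s := lim ((fun f : E => complex.Re (pairing f s)) @ F).
have evl s : (fun f : E => complex.Re (pairing f s)) @ F --> l s by exact: evc.
(* The coefficient ['i] enters [pairing] conjugated, so the second real part is the imaginary part
   of the value at [x]. *)
pose L x : R[i] := l [:: (1, x)] +i* l [:: ('i, x)].
have Ll s : complex.Re (pairing L s) = l s.
  suff : (fun f : E => complex.Re (pairing f s)) @ F --> complex.Re (pairing L s).
    by move/cvg_lim => <-.
  elim: s => [|[c x] s IH].
    rewrite (_ : (fun _ => _) = cst 0); last first.
      by apply/funext => f; rewrite /pairing big_nil.
    by rewrite /pairing big_nil; exact: cvg_cst.
  rewrite (_ : (fun _ => _) = (fun f : E => complex.Re c * complex.Re (pairing f [:: (1, x)])
      + complex.Im c * complex.Re (pairing f [:: ('i, x)]) + complex.Re (pairing f s))).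
    have -> : complex.Re (pairing L ((c, x) :: s)) = complex.Re c * l [:: (1, x)]
        + complex.Im c * l [:: ('i, x)] + complex.Re (pairing L s).
      rewrite -cat1s pairing_cat pairing1 raddfD; congr (_ + _).
      by case: c => a b /=; lra.
    by apply: cvgD IH; apply: cvgD; apply: cvgMr; exact: evl.
  apply/funext => f; rewrite -cat1s pairing_cat !pairing1 raddfD; congr (_ + _).
  by case: c => a b /=; case: (f x) => u v /=; lra.
have gapL (g : X -> R[i]) s M (A : set E) : F A ->
    (forall f, A f -> rkhs_gap K (g - f) s <= M) -> rkhs_gap K (g - L) s <= M.
  move=> FA gM.
  have gapE (h : X -> R[i]) : rkhs_gap K (g - h) s =
      2 * complex.Re (pairing g s) - comb_sqnorm K s - 2 * complex.Re (pairing h s).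
    by rewrite /rkhs_gap pairingD pairingN raddfB; ring.
  rewrite gapE Ll lerBlDr -lerBlDl -ler_pdivrMl//.
  apply: (limr_ge (evc s)); apply: filterS FA => f /gM; rewrite gapE; lra.
have [A FA Ad] := rkhs_cauchy FF Fc (@ltr01 R).
have [f0 Af0] := filter_ex FA.
have LE : L \in rkhs_pred K.
  (* Only differences have controlled gaps; [L] is then recovered as [f0 - (f0 - L)]. *)
  have LE : (rkhs_fun f0 - L : X -> R[i]) \in rkhs_pred K.
    apply/asboolP; exists 1 => s; apply: (gapL f0 s 1 A FA) => f Af.
    by apply: le_trans (rkhs_gap_le (f0 - f : E) s) _; apply/ltW/Ad.
  rewrite -(subKr (rkhs_fun f0) L).
  by apply: rpredB => //; exact: rkhs_funP.
apply/cvg_ex; exists (Rkhs LE : E); apply/cvgrPdist_lt => e /gt0_complex[r r0 ->].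
have r20 : 0 < r ^+ 2 / 2 by rewrite divr_gt0// exprn_gt0.
have [B FB Bd] := rkhs_cauchy FF Fc r20.
apply: filterS (FB) => f Bf; rewrite distrC rkhs_norm_lt//.
apply: (@le_lt_trans _ _ (r ^+ 2 / 2)); last by lra.
apply: rkhs_sqnorm_le => s; apply: (gapL f s _ B) => // h Bh.
by apply: le_trans (rkhs_gap_le (f - h : E) s) _; apply/ltW/Bd.
Qed.

HB.instance Definition _ := Uniform_isComplete.Build E rkhs_complete.

Definition rkhs_dot : E -> E -> R[i] := jvn_dot (@rkhs_sqnorm R X K).

Lemma rkhs_dot_linear (g : E) : linear_for *%R (rkhs_dot^~ g).
Proof.
apply: jvn_dot_linear.
- exact: rkhs_sqnorm_ge0.
- exact: rkhs_sqnormZ.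
- exact: rkhs_parallelogram.
Qed.

Lemma rkhs_dot_hermitian (f g : E) : rkhs_dot f g = Num.conj (rkhs_dot g f).
Proof.
apply: jvn_dot_hermitian.
- exact: rkhs_sqnormZ.
- exact: rkhs_parallelogram.
Qed.

Lemma rkhs_dotxx (f : E) : rkhs_dot f f = (rkhs_sqnorm f)%:C.
Proof.
apply: jvn_dotxx.
- exact: rkhs_sqnormZ.
- exact: rkhs_parallelogram.
Qed.

Lemma rkhs_dot_bilinear : bilinear_for *%R (Num.conj \; *%R) rkhs_dot.
Proof.
split=> [g|f a g h]; first exact: rkhs_dot_linear.
have -> : rkhs_dot f (a *: g + h) =
    Num.conj a * Num.conj (rkhs_dot g f) + Num.conj (rkhs_dot h f).
  rewrite (rkhs_dot_hermitian f (a *: g + h)) rkhs_dot_linear.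
  by move: (rkhs_dot g f) (rkhs_dot h f) => u v; rewrite rmorphD rmorphM.
by rewrite (rkhs_dot_hermitian f g) (rkhs_dot_hermitian f h).
Qed.

Lemma rkhs_dot_gt0 (f : E) : f != 0 -> 0 < rkhs_dot f f.
Proof.
move=> f0; rewrite rkhs_dotxx ltcR lt0r rkhs_sqnorm_ge0 andbT.
by apply: contra f0 => /eqP /rkhs_sqnorm_eq0 ->.
Qed.

HB.instance Definition _ := bilinear_isBilinear.Build R[i] E E R[i]
  *%R (Num.conj \; *%R) rkhs_dot rkhs_dot_bilinear.
HB.instance Definition _ := isHermitianSesquilinear.Build R[i] E false
  (@Num.conj R[i]) rkhs_dot (fun f g => etrans (rkhs_dot_hermitian f g) (esym (mul1r _))).
HB.instance Definition _ := isDotProduct.Build R[i] E rkhs_dot rkhs_dot_gt0.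

Lemma rkhs_dot_norm (f : E) : rkhs_dot f f = `|f| ^+ 2.
Proof. by rewrite rkhs_dotxx rkhs_normE -rmorphXn /= sqr_sqrtr// rkhs_sqnorm_ge0. Qed.

HB.instance Definition _ := CompleteNormedModule_isHilbert.Build R E rkhs_dot_norm.


End RkhsHilbert.

(** * The dense subspace of finite kernel combinations *)

Section KernelElements.
Variables (R : realType) (X : Type) (K : psd_kernel R X).
Local Notation E := (rkhs K).
Local Notation N := (@rkhs_sqnorm R X K).

Lemma rkhs_sqnormD_le (f g : E) : N (f + g) <= 2 * N f + 2 * N g.
Proof.
have := rkhs_parallelogram f g; have := rkhs_sqnorm_ge0 (f - g); lra.
Qed.

Lemma rkhs_sqnormN (f : E) : N (- f) = N f.
Proof.
by rewrite -scaleN1r rkhs_sqnormZ /= oppr0 sqrrN expr1n expr0n addr0 mul1r.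
Qed.

Lemma rkhs_gap_shift f s t : rkhs_gap K (f - kernel_comb K s) t =
  rkhs_gap K f (t ++ s) - rkhs_gap K f s.
Proof.
rewrite /rkhs_gap comb_sqnorm_cat pairing_cat pairingD pairingN !raddfD raddfN /=.
rewrite (pairing_kernel_combC K t s).
by case: (pairing (kernel_comb K t) s) => a b /=; lra.
Qed.

(** This is the positivity of the squared norm of the difference of the two combinations. *)
Lemma rkhs_gap_kernel_comb s t : rkhs_gap K (kernel_comb K s) t <= comb_sqnorm K s.
Proof.
have := comb_sqnorm_ge0 K (scale_comb (- 1)%:C t ++ s).
rewrite comb_sqnorm_cat comb_sqnorm_scale_real kernel_comb_scale pairingZ.
rewrite (pairing_kernel_combC K s t) /rkhs_gap.
by case: (pairing (kernel_comb K s) t) => a b /=; lra.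
Qed.

Lemma kernel_comb_rkhs s : kernel_comb K s \in rkhs_pred K.
Proof. by apply/asboolP; exists (comb_sqnorm K s) => t; exact: rkhs_gap_kernel_comb. Qed.

Definition kernel_elt s : E := Rkhs (kernel_comb_rkhs s).

Lemma kernel_elt_sqnorm s : N (kernel_elt s) = comb_sqnorm K s.
Proof.
apply/eqP; rewrite eq_le; apply/andP; split.
  by apply: rkhs_sqnorm_le => t; exact: rkhs_gap_kernel_comb.
apply: le_trans (rkhs_gap_le (kernel_elt s) s).
by rewrite /rkhs_gap /= /comb_sqnorm; lra.
Qed.

Lemma kernel_elt_cat s t : kernel_elt (s ++ t) = kernel_elt s + kernel_elt t.
Proof. by apply: rkhs_ext => x; rewrite rkhs_funD /= kernel_comb_cat. Qed.

Lemma kernel_elt_scaleN1 s :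
  kernel_elt (scale_comb (- 1)%:C s) = - kernel_elt s.
Proof.
apply: rkhs_ext => x; rewrite rkhs_funN /= kernel_comb_scale rmorphN rmorph1.
by rewrite scaleN1r.
Qed.

(** By [rkhs_gap_shift], the gap of [f - kernel_elt s] anywhere is at most the amount by which [s]
    fails to be optimal for [f]. *)
Lemma kernel_elt_dense (f : E) e : 0 < e -> exists s, N (f - kernel_elt s) < e.
Proof.
move=> e0; have e20 : 0 < e / 2 by rewrite divr_gt0.
have [s fs] := rkhs_sqnorm_adherent f e20; exists s.
apply: (@le_lt_trans _ _ (e / 2)); last by lra.
apply: rkhs_sqnorm_le => t.
have -> : ((f - kernel_elt s : E) : X -> R[i]) = rkhs_fun f - kernel_comb K s by [].
by rewrite rkhs_gap_shift; have := rkhs_gap_le f (t ++ s); lra.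
Qed.

End KernelElements.

(** * The unitary representation by translation of a kernel-preserving action *)

Section TranslationRepresentation.
Variables (R : realType) (G : topologicalGroupType) (X : Type) (K : psd_kernel R X).
Variable act : G -> X -> X.
Hypothesis act1 : forall x, act 1%g x = x.
Hypothesis actM : forall g h x, act (g * h)%g x = act g (act h x).
Hypothesis kernel_act : forall g x y, K (act g x) (act g y) = K x y.
Hypothesis kernel_cont : forall x e, 0 < e ->
  \forall g \near 1%g, complex.Re (K x x) - complex.Re (K (act g x) x) < e.
Local Notation E := (rkhs K).
Local Notation N := (@rkhs_sqnorm R X K).

Lemma actK g : cancel (act g) (act g^-1%g).
Proof. by move=> x; rewrite -actM mulVg act1. Qed.

Definition translate_comb g (s : seq (R[i] * X)) := [seq (p.1, act g p.2) | p <- s].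

Lemma pairing_translate f g s :
  pairing (fun x => f (act g^-1%g x)) s = pairing f (translate_comb g^-1%g s).
Proof. by rewrite /pairing big_map. Qed.

Lemma kernel_comb_translate g s x :
  kernel_comb K s (act g^-1%g x) = kernel_comb K (translate_comb g s) x.
Proof.
rewrite /kernel_comb big_map; apply: eq_bigr => p _ /=.
by rewrite -{1}(actK g p.2) kernel_act.
Qed.

Lemma comb_sqnorm_translate g s : comb_sqnorm K (translate_comb g s) = comb_sqnorm K s.
Proof.
rewrite /comb_sqnorm !pairing_kernel_comb; congr (complex.Re _).
rewrite big_map; apply: eq_bigr => p _; rewrite big_map; apply: eq_bigr => r _ /=.
by rewrite kernel_act.
Qed.

Lemma translate_rkhs g (f : E) : (fun x => f (act g^-1%g x)) \in rkhs_pred K.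
Proof.
have /asboolP[M fM] := rkhs_funP f; apply/asboolP; exists M => s.
have := fM (translate_comb g^-1%g s).
by rewrite /rkhs_gap comb_sqnorm_translate pairing_translate.
Qed.

Definition translate g (f : E) : E := Rkhs (translate_rkhs g f).

Lemma translate1 f : translate 1%g f = f.
Proof. by apply: rkhs_ext => x /=; rewrite invg1 act1. Qed.

Lemma translateM g h f : translate (g * h)%g f = translate g (translate h f).
Proof. by apply: rkhs_ext => x /=; rewrite invgM actM. Qed.

Lemma translate_linear g : linear (translate g).
Proof. by move=> a f h; apply: rkhs_ext. Qed.

Lemma translateB g f h : translate g (f - h) = translate g f - translate g h.
Proof. exact: rkhs_ext. Qed.

Lemma translateD g f h : translate g (f + h) = translate g f + translate g h.
Proof. exact: rkhs_ext. Qed.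

Lemma translate_sqnorm g f : N (translate g f) = N f.
Proof.
have le h (u : E) : N (translate h u) <= N u.
  apply: rkhs_sqnorm_le => s; rewrite /rkhs_gap /= pairing_translate.
  by rewrite -(comb_sqnorm_translate h^-1%g); exact: rkhs_gap_le.
apply/eqP; rewrite eq_le le /= -{1}(translate1 f) -(mulVg g) translateM.
exact: le.
Qed.

Lemma translate_unitary g : unitary_operator (translate g).
Proof.
split=> [|f h|f]; first exact: translate_linear.
  have pE u v : polar N (translate g u) (translate g v) = polar N u v.
    by rewrite /polar -translateD -translateB !translate_sqnorm.
  have iE : 'i *: translate g h = translate g ('i *: h) by apply: rkhs_ext.
  suff : rkhs_dot (translate g f) (translate g h) = rkhs_dot f h by [].
  by rewrite /rkhs_dot /jvn_dot iE !pE.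
by exists (translate g^-1%g f); rewrite -translateM mulgV translate1.
Qed.

Definition translate_rep g : unitary_group E := Unitary (translate_unitary g).

Lemma translate_kernel_elt g s :
  translate g (kernel_elt K s) = kernel_elt K (translate_comb g s).
Proof. by apply: rkhs_ext => x /=; rewrite kernel_comb_translate. Qed.

(** For one term [c K_x] the squared distance to its translate is
    [2 |c|^2 (K(x, x) - Re K(g x, x))], which [kernel_cont] makes small; further terms are added by
    induction. *)
Lemma translate_kernel_elt_near s e : 0 < e ->
  \forall g \near 1%g, N (kernel_elt K s - translate g (kernel_elt K s)) < e.
Proof.
elim: s e => [|[c x] s IH] e e0.
  apply: nearW => g; rewrite translate_kernel_elt /= subrr -(scale0r 0).
  by rewrite rkhs_sqnormZ /= expr0n addr0 mul0r.
have e40 : 0 < e / 4 by rewrite divr_gt0.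
pose A := complex.Re c ^+ 2 + complex.Im c ^+ 2.
have A0 : 0 <= A by rewrite addr_ge0// sqr_ge0.
(* This makes the new term contribute at most [e / 4]; adding 1 to [A] covers [c = 0]. *)
have e' : 0 < e / (8 * (A + 1)) by rewrite divr_gt0// mulr_gt0// ltr_wpDl.
apply: filterS2 (kernel_cont x e') (IH _ e40) => g gx gs.
rewrite -cat1s kernel_elt_cat translateD opprD addrACA.
apply: le_lt_trans (rkhs_sqnormD_le _ _) _.
suff : N (kernel_elt K [:: (c, x)] - translate g (kernel_elt K [:: (c, x)])) <= e / 4 by lra.
rewrite translate_kernel_elt.
have -> : kernel_elt K [:: (c, x)] - kernel_elt K (translate_comb g [:: (c, x)]) =
    kernel_elt K [:: (c, x); (- c, act g x)].
  apply: rkhs_ext => y; rewrite rkhs_funD rkhs_funN.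
  rewrite -[LHS]/(kernel_comb K [:: (c, x)] y - kernel_comb K [:: (c, act g x)] y).
  by rewrite /= /kernel_comb !big_seq1 big_cons big_seq1 /= mulNr.
rewrite kernel_elt_sqnorm /comb_sqnorm /pairing /kernel_comb.
rewrite !big_cons !big_nil /= !addr0 kernel_act (kernel_hermitian K (act g x) x).
move: gx; rewrite ltr_pdivlMr ?mulr_gt0 ?ltr_wpDl//.
have Kim : complex.Im (K x x) = 0.
  have := kernel_hermitian K x x; case: (K x x) => u v /= /eqP.
  by rewrite eq_complex /= eqxx /= => /eqP; lra.
move: Kim A0; rewrite /A; case: (K x x) => k k'; case: (K _ _) => l l'.
case: c {A e'} => a b /= -> A0 gx.
set lhs := (X in X <= _).
have {lhs}-> : lhs = 2 * ((a ^+ 2 + b ^+ 2) * (k - l)) by rewrite /lhs; ring.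
have [kl|kl] := leP 0 (k - l); first by lra.
suff : (a ^+ 2 + b ^+ 2) * (k - l) <= 0 by lra.
by rewrite mulr_ge0_le0// ltW.
Qed.

Lemma translate_near (f : E) e : 0 < e ->
  \forall g \near 1%g, N (f - translate g f) < e.
Proof.
(* Splitting twice gives at most six times the squared distance from [f] to [k] plus four times that
   from [k] to its translate, hence less than [10 e / 12]. *)
move=> e0; have e120 : 0 < e / 12 by rewrite divr_gt0.
have [s fs] := kernel_elt_dense f e120.
have e'0 : 0 < e / 12 by rewrite divr_gt0.
apply: filterS (translate_kernel_elt_near s e'0) => g gs.
set k := kernel_elt K s in fs gs.
have -> : f - translate g f = (f - k) + ((k - translate g k) - translate g (f - k)).
  by rewrite translateB opprB !subrKA.
have := rkhs_sqnormD_le (f - k) ((k - translate g k) - translate g (f - k)).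
have := rkhs_sqnormD_le (k - translate g k) (- translate g (f - k)).
by rewrite rkhs_sqnormN translate_sqnorm; lra.
Qed.

Lemma translate_representation : unitary_representation translate_rep.
Proof.
split=> [g h|]; first by apply: unitary_ext => f; exact: translateM.
apply: (@continuous_comp_initial (unitary_group E) G {ptws E -> E}
  (@unitary_fun R E) translate_rep).
apply: pointwise_continuous => f g0; apply/cvgrPdist_lt => e /gt0_complex[r r0 ->].
have r20 : 0 < r ^+ 2 by rewrite exprn_gt0.
have cg : (g0^-1 * g)%g @[g --> g0] --> (g0^-1 * g0)%g.
  exact: mulg_continuousl.
rewrite mulVg in cg.
have gN : \forall g \near g0, N (f - translate (g0^-1 * g)%g f) < r ^+ 2.
  exact: (cg _ (translate_near f r20)).
apply: filterS gN => g gr; rewrite rkhs_norm_lt//.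
rewrite -(translate_sqnorm g0^-1%g) translateB -!translateM mulVg translate1.
exact: gr.
Qed.

End TranslationRepresentation.

Local Notation "M ^h" := (map_mx Num.conj (trmx M)) (at level 1, format "M ^h").

(** * The Powers-Stormer inequality for matrices *)

Section HermitianMatrices.
Variable C : numClosedFieldType.

Lemma adjmxM m n p (A : 'M[C]_(m, n)) (B : 'M[C]_(n, p)) : (A *m B)^h = B^h *m A^h.
Proof. by rewrite trmx_mul map_mxM. Qed.

Lemma adjmxK m n (A : 'M[C]_(m, n)) : A^h^h = A.
Proof. by apply/matrixP => i j; rewrite !mxE conjCK. Qed.

Lemma adjmxB m n (A B : 'M[C]_(m, n)) : (A - B)^h = A^h - B^h.
Proof. by apply/matrixP => i j; rewrite !mxE rmorphB. Qed.

Lemma adj_diag_mx n (d : 'rV[C]_n) : (forall i, d 0 i \is Num.real) ->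
  (diag_mx d)^h = diag_mx d.
Proof.
move=> dr; apply/matrixP => i j; rewrite !mxE rmorphMn /=.
have [->|ij] := eqVneq i j; first by rewrite (CrealP (dr j)).
by rewrite !mulr0n.
Qed.

Lemma mulmx_adj_diag_ge0 m n (A : 'M[C]_(m, n)) i : 0 <= (A *m A^h) i i.
Proof.
by rewrite mxE sumr_ge0// => j _; rewrite !mxE mul_conjC_ge0.
Qed.

Lemma mulmx_adj_diagE m n (A : 'M[C]_(m, n)) i :
  (A *m A^h) i i = \sum_j `|A i j| ^+ 2.
Proof. by rewrite mxE; apply: eq_bigr => j _; rewrite !mxE normCK. Qed.

Lemma hermitian_diagonalization n (A : 'M[C]_n) : A^h = A ->
  exists P (d : 'rV[C]_n), [/\ P *m P^h = 1%:M, P^h *m P = 1%:M,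
    forall i, d 0 i \is Num.real & A = P^h *m diag_mx d *m P].
Proof.
move=> Ah.
have Aherm : A \is hermsymmx.
  by apply/is_hermitianmxP; rewrite expr0 scale1r Ah.
have Pu := spectral_unitarymx A.
exists (spectralmx A), (spectral_diag A); split.
- exact/unitarymxP.
- by rewrite -(invmx_unitary Pu) mulVmx// spectral_unit.
- move=> i; have /mxOverP := hermitian_spectral_diag_real Aherm; exact.
- have /hermitian_normalmx /orthomx_spectralP := Aherm.
  by rewrite (invmx_unitary Pu).
Qed.

Lemma mul_diag_mxE m n (d : 'rV[C]_m) (A : 'M[C]_(m, n)) i j :
  (diag_mx d *m A) i j = d 0 i * A i j.
Proof. by rewrite mul_diag_mx mxE. Qed.

Lemma mul_mx_diagE m n (d : 'rV[C]_n) (A : 'M[C]_(m, n)) i j :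
  (A *m diag_mx d) i j = A i j * d 0 j.
Proof. by rewrite mul_mx_diag mxE. Qed.

(** Testing positivity on the rows of the diagonalizing matrix shows that the eigenvalues are
    nonnegative; their square roots give the factor [B]. *)
Lemma psd_mx_sqrt n (A : 'M[C]_n) : A^h = A ->
  (forall x : 'rV[C]_n, 0 <= (x *m A *m x^h) 0 0) -> exists B : 'M[C]_n, A = B *m B^h.
Proof.
move=> /hermitian_diagonalization[P [d [PP _ dr ->]]] pos.
have d0 i : 0 <= d 0 i.
  have := pos (row i P); rewrite (_ : _ 0 0 = d 0 i)// !mulmxA.
  have -> : row i P *m P^h = delta_mx 0 i by rewrite -row_mul PP row1.
  rewrite -!mulmxA (_ : P *m (row i P)^h = (delta_mx 0 i)^h); last first.
    by rewrite -(adjmxK P) -adjmxM -row_mul adjmxK PP row1.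
  rewrite mul_diag_mx mxE (bigD1 i)//= big1 => [|j ji].
    by rewrite !mxE !eqxx /= mul1r rmorph1 mulr1 addr0.
  by rewrite !mxE eqxx (negbTE ji) /= mul0r.
exists (P^h *m diag_mx (map_mx sqrtC d)); rewrite adjmxM adjmxK adj_diag_mx; last first.
  by move=> i; rewrite mxE ger0_real// sqrtC_ge0.
rewrite !mulmxA -(mulmxA P^h (diag_mx (map_mx sqrtC d))) mulmx_diag; congr (_ *m diag_mx _ *m _).
by apply/rowP => i; rewrite !mxE -expr2 sqrtCK.
Qed.

Lemma mulmx_adj_eq0 m n (A : 'M[C]_(m, n)) i : (A *m A^h) i i = 0 ->
  forall j, A i j = 0.
Proof.
rewrite mulmx_adj_diagE => /eqP; rewrite psumr_eq0 => [/allP A0 j|j _].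
  by have := A0 j (mem_index_enum j); rewrite /= sqrf_eq0 normr_eq0 => /eqP.
by rewrite exprn_ge0.
Qed.

(* Here [e^h *m e] is the pseudo-inverse square root of the Gram matrix [N], so
   that [S] is the positive square root of [V^h *m V]. *)
Lemma gram_inv_sqrt n (N : 'M[C]_n) :
  (exists p (V : 'M[C]_(n, p)), N = V *m V^h) ->
  exists e : 'M[C]_n, forall m (V : 'M[C]_(n, m)), V *m V^h = N ->
    let S := V^h *m (e^h *m e) *m V in S *m S = V^h *m V.
Proof.
move=> [p [V0 NV0]].
have Nh : N^h = N by rewrite NV0 adjmxM adjmxK.
have [P [d [PP PP' dr NE]]] := hermitian_diagonalization Nh.
have gram m (V : 'M[C]_(n, m)) : V *m V^h = N -> (P *m V) *m (P *m V)^h = diag_mx d.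
  move=> VN; rewrite adjmxM mulmxA -(mulmxA P) VN NE !mulmxA PP mul1mx.
  by rewrite -mulmxA PP mulmx1.
have d0 i : 0 <= d 0 i.
  have := mulmx_adj_diag_ge0 (P *m V0) i; rewrite (gram _ _ (esym NV0)).
  by rewrite mxE eqxx mulr1n.
(* Inverse fourth roots, because [q] occurs twice in [e^h *m e]. The convention that the inverse of
   0 is 0 yields the pseudo-inverse. *)
pose q : 'rV[C]_n := \row_i (sqrtC (sqrtC (d 0 i)))^-1.
have qr i : q 0 i \is Num.real.
  by rewrite mxE ger0_real// invr_ge0 !sqrtC_ge0.
exists (diag_mx q *m P) => m V VN /=.
rewrite adjmxM adj_diag_mx//.
have [Y YE] : exists Y, Y = P *m V by exists (P *m V).
have YN := gram _ _ VN; rewrite -YE in YN.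
have SE : V^h *m (P^h *m diag_mx q *m (diag_mx q *m P)) *m V =
    Y^h *m diag_mx (\row_i (sqrtC (d 0 i))^-1) *m Y.
  rewrite YE adjmxM !mulmxA -(mulmxA _ (diag_mx q) (diag_mx q)) mulmx_diag.
  congr (_ *m diag_mx _ *m _ *m _); apply/rowP => i.
  by rewrite !mxE -invfM -expr2 sqrtCK.
rewrite SE !mulmxA -(mulmxA _ Y Y^h) YN.
have -> : V^h *m V = Y^h *m Y by rewrite YE adjmxM mulmxA -(mulmxA _ P^h) PP' mulmx1.
rewrite -!mulmxA; congr (_ *m _); apply/matrixP => i j.
rewrite !mul_diag_mxE !mxE.
(* A zero eigenvalue of the Gram matrix forces the corresponding row of [Y] to vanish. *)
have [di|di] := eqVneq (d 0 i) 0.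
  rewrite [Y i j](@mulmx_adj_eq0 _ _ Y i) ?mulr0//.
  by rewrite YN mxE eqxx mulr1n.
have sd : sqrtC (d 0 i) != 0 by rewrite sqrtC_eq0.
by rewrite -[d 0 i in X in _ * (X * _)]sqrtCK expr2 !mulrA mulVf// mul1r mulfV// mul1r.
Qed.

(** In an eigenbasis of [S - T], an eigenvalue is the difference [P j j - Q j j] of nonnegative
    diagonal entries, so its modulus is at most their sum. Its square is then at most its sign times
    the diagonal entry of [P^2 - Q^2]. The signs are kept explicit so that the bound reads as a
    difference of values of one quadratic form. *)
Lemma powers_stormer n m (V W : 'M[C]_(n, m)) (e : 'M[C]_n) :
  let S := V^h *m (e^h *m e) *m V in let T := W^h *m (e^h *m e) *m W in
  S *m S = V^h *m V -> T *m T = W^h *m W ->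
  exists (U : 'M[C]_m) (s : 'I_m -> C),
  [/\ U *m U^h = 1%:M, U^h *m U = 1%:M, forall j, (s j == 1) || (s j == -1) &
    \tr ((S - T) *m (S - T)^h) <=
    \sum_j s j * \sum_i (`|(V *m U^h) i j| ^+ 2 - `|(W *m U^h) i j| ^+ 2)].
Proof.
move=> S T SS TT.
have Sh : S^h = S by rewrite /S !adjmxM !adjmxK !mulmxA.
have Th : T^h = T by rewrite /T !adjmxM !adjmxK !mulmxA.
have Dh : (S - T)^h = S - T by rewrite adjmxB Sh Th.
have [U [d [UU UU' dr DE]]] := hermitian_diagonalization Dh.
exists U, (fun j => if 0 <= d 0 j then 1 else -1); split=> //.
  by move=> j; case: ifP; rewrite eqxx ?orbT.
have [P defP] : exists P, P = U *m S *m U^h by eexists.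
have [Q defQ] : exists Q, Q = U *m T *m U^h by eexists.
have DE' : P - Q = diag_mx d.
  rewrite defP defQ -mulmxBl -mulmxBr DE !mulmxA UU mul1mx -mulmxA UU mulmx1 //.
have sq (A : 'M[C]_m) : (U *m A *m U^h) *m (U *m A *m U^h) = U *m (A *m A) *m U^h.
  by rewrite !mulmxA -(mulmxA _ U^h U) UU' mulmx1.
have sqE p (A : 'M[C]_(p, m)) : U *m (A^h *m A) *m U^h = (A *m U^h)^h *m (A *m U^h).
  by rewrite adjmxM adjmxK !mulmxA.
have diagE p (A : 'M[C]_(p, m)) j : (A^h *m A) j j = \sum_i `|A i j| ^+ 2.
  rewrite -{2}(adjmxK A) mulmx_adj_diagE; apply: eq_bigr => i _.
  by rewrite !mxE norm_conjC.
have pos (A : 'M[C]_(n, m)) j : 0 <= (U *m (A^h *m (e^h *m e) *m A) *m U^h) j j.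
  have -> : A^h *m (e^h *m e) *m A = (e *m A)^h *m (e *m A) by rewrite adjmxM !mulmxA.
  by rewrite sqE diagE sumr_ge0// => i _; rewrite exprn_ge0.
have S0 j : 0 <= P j j by rewrite defP; exact: pos.
have T0 j : 0 <= Q j j by rewrite defQ; exact: pos.
have dE j : d 0 j = P j j - Q j j.
  by have /matrixP /(_ j j) := DE'; rewrite !mxE eqxx mulr1n.
have trE : \tr ((S - T) *m (S - T)^h) = \sum_j d 0 j ^+ 2.
  have -> : (S - T) *m (S - T)^h = U^h *m (diag_mx d *m diag_mx d) *m U.
    rewrite Dh DE !mulmxA -(mulmxA _ U U^h) UU mulmx1.
    by rewrite -(mulmxA _ (diag_mx d) (diag_mx d)).
  rewrite mxtrace_mulC !mulmxA UU mul1mx mulmx_diag mxtrace_diag.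
  by apply: eq_bigr => j _; rewrite !mxE expr2.
rewrite trE; apply: ler_sum => j _.
have -> : \sum_i (`|(V *m U^h) i j| ^+ 2 - `|(W *m U^h) i j| ^+ 2) =
    (P *m P - Q *m Q) j j.
  rewrite defP defQ !sq SS TT !sqE sumrB -!diagE.
  by rewrite [RHS]mxE [X in _ = _ + X]mxE.
(* [P] and [Q] need not commute, but since [P - Q] is diagonal the identity holds on the
   diagonal. *)
have -> : (P *m P - Q *m Q) j j = d 0 j * (P j j + Q j j).
  have E : P = Q + diag_mx d by rewrite -DE' addrC subrK.
  have -> : P *m P - Q *m Q = diag_mx d *m Q + Q *m diag_mx d + diag_mx d *m diag_mx d.
    rewrite E mulmxDl !mulmxDr.
    move: (Q *m Q) (Q *m diag_mx d) (diag_mx d *m Q) (diag_mx d *m diag_mx d).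
    by move=> x y z t; rewrite addrAC [x + y]addrC addrK addrA [y + z]addrC.
  rewrite mxE [X in X + _]mxE mul_diag_mxE mul_mx_diagE mul_diag_mxE.
  rewrite [diag_mx d j j]mxE eqxx mulr1n.
  by rewrite dE; ring.
have sumP0 : 0 <= P j j + Q j j by rewrite addr_ge0.
have dle : `|d 0 j| <= P j j + Q j j.
  by rewrite dE; apply: le_trans (ler_normB _ _) _; rewrite !ger0_norm.
have -> : (if 0 <= d 0 j then 1 else -1) * (d 0 j * (P j j + Q j j)) =
    `|d 0 j| * (P j j + Q j j).
  have [d0|] := boolP (0 <= d 0 j); first by rewrite mul1r ger0_norm.
  rewrite -real_ltNge ?real0// => dn0; first by rewrite ltr0_norm// mulN1r mulNr.
rewrite -[d 0 j ^+ 2]real_normK// expr2.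
by apply: ler_wpM2l.
Qed.

End HermitianMatrices.

(** * Real-valued norms, inner products and Gram matrices in a Hilbert space *)

Section HilbertBasics.
Variables (R : realType) (H : hilbertType R).
Implicit Types x y z : H.

Lemma innerC x y : inner y x = Num.conj (inner x y).
Proof. by rewrite hermC /= expr0 mul1r. Qed.

Lemma innerDl x y z : inner (x + y) z = inner x z + inner y z.
Proof. exact: linearDl. Qed.

Lemma innerZl (a : R[i]) x z : inner (a *: x) z = a * inner x z.
Proof. exact: linearZl_LR. Qed.

Lemma innerNl x z : inner (- x) z = - inner x z.
Proof. by rewrite -scaleN1r innerZl mulN1r. Qed.

Lemma innerBl x y z : inner (x - y) z = inner x z - inner y z.
Proof. by rewrite innerDl innerNl. Qed.

Lemma innerBr x y z : inner z (x - y) = inner z x - inner z y.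
Proof. by rewrite innerC innerBl rmorphB /= -!innerC. Qed.

Lemma innerZr (a : R[i]) x z : inner z (a *: x) = Num.conj a * inner z x.
Proof. by rewrite innerC innerZl rmorphM /= -innerC. Qed.

Lemma inner_suml (I : Type) (r : seq I) (F : I -> H) z :
  inner (\sum_(i <- r) F i) z = \sum_(i <- r) inner (F i) z.
Proof.
elim: r => [|i r IH]; last by rewrite !big_cons innerDl IH.
by rewrite !big_nil -(scale0r 0) innerZl mul0r.
Qed.

Lemma inner_sumr (I : Type) (r : seq I) (F : I -> H) z :
  inner z (\sum_(i <- r) F i) = \sum_(i <- r) inner z (F i).
Proof.
by rewrite innerC inner_suml rmorph_sum; apply: eq_bigr => i _ /=; rewrite -innerC.
Qed.

Definition sqn x : R := complex.Re (inner x x).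
Definition rin x y : R := complex.Re (inner x y).
Definition nrm x : R := Num.sqrt (sqn x).

Lemma innerxx x : inner x x = (sqn x)%:C.
Proof.
have := innerC x x; rewrite /sqn; case: (inner x x) => a b /eqP.
rewrite eq_complex /= eqxx /= => /eqP bb.
by apply/eqP; rewrite eq_complex /= eqxx /=; apply/eqP; lra.
Qed.

Lemma sqn_ge0 x : 0 <= sqn x.
Proof. by rewrite -(@ler0c R) -innerxx inner_norm exprn_ge0. Qed.

Lemma norm_nrm x : `|x| = (nrm x)%:C.
Proof.
apply/eqP; rewrite -(@eqrXn2 _ 2)//; last by rewrite ler0c sqrtr_ge0.
by rewrite -inner_norm innerxx -rmorphXn /= sqr_sqrtr// sqn_ge0.
Qed.

Lemma nrm_ge0 x : 0 <= nrm x. Proof. exact: sqrtr_ge0. Qed.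

Lemma sqr_nrm x : nrm x ^+ 2 = sqn x.
Proof. by rewrite sqr_sqrtr// sqn_ge0. Qed.

Lemma nrm_triangle x y : nrm (x + y) <= nrm x + nrm y.
Proof. by rewrite -lecR rmorphD /= -!norm_nrm ler_normD. Qed.

Lemma nrmN x : nrm (- x) = nrm x.
Proof. by apply: (@complexI R); rewrite -!norm_nrm normrN. Qed.

Lemma nrm_eq0 x : nrm x = 0 -> x = 0.
Proof. by move=> x0; apply/eqP; rewrite -normr_eq0 norm_nrm x0. Qed.

Lemma rinC x y : rin y x = rin x y.
Proof. by rewrite /rin innerC; case: (inner x y). Qed.

Lemma rinBl x y z : rin (x - y) z = rin x z - rin y z.
Proof. by rewrite /rin innerBl raddfB. Qed.

Lemma sqnB x y : sqn (x - y) = sqn x + sqn y - 2 * rin x y.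
Proof.
rewrite /sqn innerBl !innerBr !raddfB /= -[complex.Re (inner y x)]/(rin y x) rinC.
by rewrite /rin; lra.
Qed.

Lemma sqnZ (a : R[i]) x :
  sqn (a *: x) = (complex.Re a ^+ 2 + complex.Im a ^+ 2) * sqn x.
Proof. by rewrite /sqn innerZl innerZr innerxx; case: a => a b /=; ring. Qed.

Lemma rinZr_real (t : R) x y : rin x (t%:C *: y) = t * rin x y.
Proof. by rewrite /rin innerZr; case: (inner x y) => a b /=; ring. Qed.

Lemma rin_cauchy_schwarz x y : rin x y ^+ 2 <= sqn x * sqn y.
Proof.
apply: real_quadratic_le => [|t]; first exact: sqn_ge0.
by have := sqn_ge0 (x - t%:C *: y); rewrite sqnB sqnZ rinZr_real /= expr0n addr0; lra.
Qed.

Lemma norm_rin_le x y : `|rin x y| <= nrm x * nrm y.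
Proof.
rewrite -(@ler_pXn2r _ 2) ?nnegrE ?mulr_ge0 ?nrm_ge0//.
by rewrite exprMn !sqr_nrm real_normK ?num_real// rin_cauchy_schwarz.
Qed.

Lemma inner_cauchy_schwarz x y :
  complex.Re (inner x y) ^+ 2 + complex.Im (inner x y) ^+ 2 <= sqn x * sqn y.
Proof.
set A := (X in X <= _); have A0 : 0 <= A by rewrite addr_ge0// sqr_ge0.
have [->|An0] := eqVneq A 0; first by rewrite mulr_ge0 ?sqn_ge0.
have Ap : 0 < A by rewrite lt0r An0.
have := rin_cauchy_schwarz x (inner x y *: y).
have -> : rin x (inner x y *: y) = A.
  by rewrite /rin innerZr /A; case: (inner x y) => a b /=; ring.
by rewrite sqnZ -/A expr2 mulrCA ler_pM2l.
Qed.

(** The rows of [B] are coordinates having the same inner products as the given vectors, which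
    transfers questions about finitely many vectors to matrices. *)
Lemma gram_factorization n (h : 'I_n -> H) :
  exists B : 'M[R[i]]_n, forall i j, inner (h i) (h j) = (B *m B^h) i j.
Proof.
pose A : 'M[R[i]]_n := \matrix_(i, j) inner (h i) (h j).
have [||B AB] := @psd_mx_sqrt R[i] n A.
- by apply/matrixP => i j; rewrite !mxE -innerC.
- move=> x; have -> : (x *m A *m x^h) 0 0 =
      inner (\sum_i x 0 i *: h i) (\sum_i x 0 i *: h i).
    rewrite inner_sumr mxE; apply: eq_bigr => i _.
    rewrite !mxE innerZr mulrC; congr (_ * _).
    by rewrite inner_suml; apply: eq_bigr => j _; rewrite !mxE innerZl.
  by rewrite innerxx ler0c sqn_ge0.
by exists B => i j; rewrite -AB mxE.
Qed.

End HilbertBasics.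

(** * Unitary representations and the conjugation-invariant displacement *)

Section UnitaryRepresentations.
Variables (R : realType) (G : topologicalGroupType) (H : hilbertType R).
Variable pi : G -> unitary_group H.
Hypothesis pi_rep : unitary_representation pi.

Lemma repM g h x : pi (g * h)%g x = pi g (pi h x).
Proof. by have [piM _] := pi_rep; rewrite piM. Qed.

Lemma rep1 x : pi 1%g x = x.
Proof. by apply: (@unitary_inj _ _ (pi 1%g)); rewrite -repM mulg1. Qed.

Lemma repK g x : pi g^-1%g (pi g x) = x.
Proof. by rewrite -repM mulVg rep1. Qed.

Lemma rep_inner g x y : inner (pi g x) (pi g y) = inner x y.
Proof. by case: (unitary_funP (pi g)) => _ iso _; exact: iso. Qed.

Lemma repB g x y : pi g (x - y) = pi g x - pi g y.
Proof.
case: (unitary_funP (pi g)) => lin _ _.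
by rewrite addrC -scaleN1r lin scaleN1r addrC.
Qed.

Lemma repZ g a x : pi g (a *: x) = a *: pi g x.
Proof.
case: (unitary_funP (pi g)) => lin _ _.
have p0 : pi g 0 = 0 by have := repB g x x; rewrite !subrr.
by rewrite -[a *: x]addr0 lin p0 addr0.
Qed.

Lemma rep_sqn g x : sqn (pi g x) = sqn x.
Proof. by rewrite /sqn rep_inner. Qed.

Lemma rep_nrm g x : nrm (pi g x) = nrm x.
Proof. by rewrite /nrm rep_sqn. Qed.

Lemma rep_near x e : 0 < e -> \forall g \near 1%g, nrm (pi g x - x) < e.
Proof.
move=> e0; have [_ pic] := pi_rep.
have cev : continuous (fun f : {ptws H -> H} => f x) := @proj_continuous H (fun=> H) x.
have cU : continuous (@unitary_fun R H : unitary_group H -> {ptws H -> H}).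
  exact: initial_continuous.
have c1 : (fun g => pi g x) @ 1%g --> pi 1%g x.
  apply: (@continuous_comp _ _ _ pi (fun u => u x)); first exact: pic.
  by apply: (@continuous_comp _ _ _ (@unitary_fun R H : unitary_group H -> {ptws H -> H})
    (fun f => f x)); [exact: cU|exact: cev].
have ec : 0 < e%:C by rewrite ltcR.
move/cvgrPdist_lt : c1 => /(_ _ ec); apply: filterS => g.
by rewrite rep1 distrC norm_nrm ltcR.
Qed.

Variable xi : H.

(* SIN is what makes this supremum over the conjugates of [g] small near 1. *)
Definition displacement g : R := sup (range (fun h => nrm (pi (g ^ h)%g xi - xi))).

Lemma displacement_has_sup g : has_sup (range (fun h => nrm (pi (g ^ h)%g xi - xi))).
Proof.
split; first by exists (nrm (pi (g ^ 1)%g xi - xi)), 1%g.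
exists (nrm xi + nrm xi) => _ [h _ <-]; apply: le_trans (nrm_triangle _ _) _.
by rewrite nrmN rep_nrm.
Qed.

Lemma displacement_ge g h : nrm (pi (g ^ h)%g xi - xi) <= displacement g.
Proof. by apply: ub_le_sup; [case: (displacement_has_sup g)|exists h]. Qed.

Lemma displacement_le g e :
  (forall h, nrm (pi (g ^ h)%g xi - xi) <= e) -> displacement g <= e.
Proof.
by move=> ge; apply: ge_sup; [case: (displacement_has_sup g)|move=> _ [h _ <-]].
Qed.

Lemma displacement_ge0 g : 0 <= displacement g.
Proof. exact: le_trans (nrm_ge0 _) (displacement_ge g 1%g). Qed.

Lemma displacement1 : displacement 1%g = 0.
Proof.
apply/eqP; rewrite eq_le displacement_ge0 andbT; apply: displacement_le => h.
by rewrite conj1g rep1 subrr /nrm /sqn -(scale0r 0) innerZl mul0r sqrtr0.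
Qed.

Lemma displacementJ g k : displacement (g ^ k)%g = displacement g.
Proof.
have le u h : displacement (u ^ h)%g <= displacement u.
  by apply: displacement_le => l; rewrite -conjgM; exact: displacement_ge.
by apply/eqP; rewrite eq_le le /= -{1}(conjgK k g) le.
Qed.

Lemma displacementV g : displacement g^-1%g = displacement g.
Proof.
have le u : displacement u^-1%g <= displacement u.
  apply: displacement_le => h; apply: le_trans (displacement_ge u h).
  by rewrite conjVg -(rep_nrm (u ^ h)%g) repB -repM mulgV rep1 -nrmN opprB.
by apply/eqP; rewrite eq_le le /= -{1}(invgK g) le.
Qed.

Lemma displacementM g h : displacement (g * h)%g <= displacement g + displacement h.
Proof.
apply: displacement_le => k; rewrite conjMg repM.
have -> : pi (g ^ k)%g (pi (h ^ k)%g xi) - xi =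
    pi (g ^ k)%g (pi (h ^ k)%g xi - xi) + (pi (g ^ k)%g xi - xi).
  by rewrite repB subrKA.
apply: le_trans (nrm_triangle _ _) _; rewrite rep_nrm addrC.
by apply: lerD; exact: displacement_ge.
Qed.

(** This is what makes functions of the orbit vector Lipschitz for the displacement. *)
Lemma nrm_rep_displacement g h : nrm (pi g xi - pi h xi) <= displacement (g^-1 * h)%g.
Proof.
rewrite -(rep_nrm g^-1%g) repB repK -repM -nrmN opprB.
by have := displacement_ge (g^-1 * h)%g 1%g; rewrite conjg1.
Qed.

Lemma displacement_small : SIN G -> forall e, 0 < e ->
  \forall g \near 1%g, displacement g < e.
Proof.
move=> sin e e0; have e20 : 0 < e / 2 by rewrite divr_gt0.
have [V [nV VJ VW]] := sin _ (rep_near xi e20).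
apply: filterS nV => g Vg; apply: (@le_lt_trans _ _ (e / 2)); last by lra.
by apply: displacement_le => h; apply/ltW/VW/VJ.
Qed.

End UnitaryRepresentations.

(** * Extension of bounded Lipschitz functions from finite families *)

Section LipschitzExtension.
Variables (R : realType) (G : groupType) (rho : G -> R).
Hypothesis rho_ge0 : forall g, 0 <= rho g.
Hypothesis rho1 : rho 1%g = 0.
Hypothesis rhoM : forall g h, rho (g * h)%g <= rho g + rho h.

(* McShane's extension, truncated at 1. *)
Lemma lipschitz_extension n (z : 'I_n -> G) (phi : 'I_n -> R) :
  (forall p, `|phi p| <= 1) ->
  (forall p r, phi r - phi p <= rho ((z p)^-1 * z r)%g) ->
  exists f : G -> R, [/\ forall a, `|f a| <= 1,
    forall a b, f b - f a <= rho (a^-1 * b)%g & forall p, f (z p) = phi p].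
Proof.
move=> phi1 phiL.
pose f a := \big[Order.min/1]_p (phi p + rho ((z p)^-1 * a)%g).
have f_le a p : f a <= phi p + rho ((z p)^-1 * a)%g by exact: bigmin_le.
have f1 a : f a <= 1 by exact: bigmin_le_id.
exists f; split=> [a|a b|p].
- rewrite ler_norml f1 andbT; apply: le_bigmin => [|p _]; first lra.
  by have := phi1 p; rewrite ler_norml => /andP[? _]; have := rho_ge0 ((z p)^-1 * a)%g; lra.
- rewrite lerBlDr -lerBlDl; apply: le_bigmin => [|p _].
    by have := f1 b; have := rho_ge0 (a^-1 * b)%g; lra.
  have := f_le b p; have := rhoM ((z p)^-1 * a)%g (a^-1 * b)%g.
  rewrite (_ : (z p)^-1 * a * (a^-1 * b) = (z p)^-1 * b)%g; first lra.
  by rewrite mulgA -(mulgA _ a) mulgV mulg1.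
- apply/eqP; rewrite eq_le; apply/andP; split; last first.
    apply: le_bigmin => [|r _]; first by have := phi1 p; rewrite ler_norml => /andP[].
    by have := phiL r p; lra.
  by apply: le_trans (f_le _ p) _; rewrite mulVg rho1 addr0.
Qed.

End LipschitzExtension.

(** * Almost invariant Hilbert-Schmidt vectors *)

Section TensorKernel.
Variables (R : realType) (G : topologicalGroupType) (H : hilbertType R).
Variable pi : G -> unitary_group H.
Hypothesis pi_rep : unitary_representation pi.
Variable xi : H.
Hypothesis xi1 : sqn xi = 1.

Definition matcoef a b : R[i] := inner (pi a xi) (pi b xi).

Lemma matcoefC a b : matcoef b a = Num.conj (matcoef a b).
Proof. exact: innerC. Qed.

Lemma matcoefM g a b : matcoef (g * a)%g (g * b)%g = matcoef a b.
Proof. by rewrite /matcoef !(repM pi_rep) rep_inner. Qed.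

Lemma matcoefxx a : matcoef a a = 1.
Proof. by rewrite /matcoef innerxx rep_sqn xi1. Qed.

(** With [v_a = pi a xi], this is the inner product of [conj v_(p.1) (x) v_(p.2)] with
    [conj v_(q.1) (x) v_(q.2)]; conjugation of the first factor swaps its arguments. *)
Definition tensor_kernel_fun (p q : G * G) : R[i] := matcoef q.1 p.1 * matcoef p.2 q.2.

Lemma tensor_kernel_hermitian p q :
  tensor_kernel_fun q p = Num.conj (tensor_kernel_fun p q).
Proof. by rewrite /tensor_kernel_fun rmorphM /= -!matcoefC. Qed.

(** Schur product argument: factoring the Gram matrix of the second coordinates as [B *m B^h] turns
    the double sum into a sum of squared norms. *)
Lemma tensor_kernel_psd_ord n (c : 'I_n -> R[i]) (x : 'I_n -> G * G) :
  0 <= complex.Re (\sum_i \sum_j c i * Num.conj (c j) * tensor_kernel_fun (x i) (x j)).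
Proof.
have [B BE] := gram_factorization (fun i => pi (x i).2 xi).
pose y l := \sum_j Num.conj (c j * B j l) *: pi (x j).1 xi.
have -> : \sum_i \sum_j c i * Num.conj (c j) * tensor_kernel_fun (x i) (x j) =
    \sum_l inner (y l) (y l).
  rewrite exchange_big /=.
  have E l : inner (y l) (y l) = \sum_j \sum_i
      (c i * Num.conj (c j)) * (matcoef (x j).1 (x i).1 * (B i l * Num.conj (B j l))).
    rewrite inner_suml; apply: eq_bigr => j _; rewrite innerZl inner_sumr mulr_sumr.
    apply: eq_bigr => i _; rewrite innerZr conjCK /matcoef rmorphM /=; ring.
  under [RHS]eq_bigr do rewrite E.
  rewrite [RHS]exchange_big; apply: eq_bigr => j _.
  rewrite [RHS]exchange_big; apply: eq_bigr => i _ /=.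
  rewrite -!mulr_sumr /tensor_kernel_fun; congr (_ * (_ * _)).
  by rewrite /matcoef BE mxE; apply: eq_bigr => l _; rewrite !mxE.
rewrite (_ : \sum_l _ = (\sum_l sqn (y l))%:C); last first.
  by rewrite rmorph_sum; apply: eq_bigr => l _; rewrite innerxx.
by rewrite /= sumr_ge0// => l _; exact: sqn_ge0.
Qed.

Lemma tensor_kernel_psd (s : seq (R[i] * (G * G))) :
  0 <= complex.Re (\sum_(p <- s) \sum_(r <- s)
         p.1 * Num.conj r.1 * tensor_kernel_fun p.2 r.2).
Proof.
rewrite big_tnth; under eq_bigr do rewrite big_tnth.
exact: (tensor_kernel_psd_ord (fun i => (tnth (in_tuple s) i).1)
  (fun i => (tnth (in_tuple s) i).2)).
Qed.

Definition tensor_kernel : psd_kernel R (G * G)%type :=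
  PsdKernel tensor_kernel_hermitian tensor_kernel_psd.

Definition diag_act (g : G) (p : G * G) : G * G := ((g * p.1)%g, (g * p.2)%g).

Lemma diag_act1 p : diag_act 1%g p = p.
Proof. by case: p => a b; rewrite /diag_act /= !mul1g. Qed.

Lemma diag_actM g h p : diag_act (g * h)%g p = diag_act g (diag_act h p).
Proof. by rewrite /diag_act /= !mulgA. Qed.

Lemma tensor_kernel_act g p q :
  tensor_kernel (diag_act g p) (diag_act g q) = tensor_kernel p q.
Proof. by rewrite /= /tensor_kernel_fun /= !matcoefM. Qed.

Lemma tensor_kernelxx p : tensor_kernel p p = 1.
Proof. by rewrite /= /tensor_kernel_fun !matcoefxx mulr1. Qed.

Lemma matcoef_near1 a e : 0 < e ->
  \forall g \near 1%g, 1 - complex.Re (matcoef (g * a)%g a) < e.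
Proof.
move=> e0; have e20 : 0 < Num.sqrt e by rewrite sqrtr_gt0.
apply: filterS (rep_near pi_rep (pi a xi) e20) => g.
rewrite -(@ltr_pXn2r _ 2) ?nnegrE ?nrm_ge0 ?(ltW e20)// sqr_nrm sqr_sqrtr ?(ltW e0)//.
rewrite sqnB !rep_sqn// xi1 /rin /matcoef (repM pi_rep).
have := norm_rin_le (pi g (pi a xi)) (pi a xi).
rewrite !rep_nrm// /nrm xi1 sqrtr1 mulr1 ler_norml => /andP[_]; rewrite /rin; lra.
Qed.

Lemma matcoef_le1 a b : complex.Re (matcoef a b) ^+ 2 + complex.Im (matcoef a b) ^+ 2 <= 1.
Proof.
by have := inner_cauchy_schwarz (pi a xi) (pi b xi); rewrite !rep_sqn// xi1 mulr1.
Qed.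

Lemma tensor_kernel_continuous p e : 0 < e -> \forall g \near 1%g,
  complex.Re (tensor_kernel p p) - complex.Re (tensor_kernel (diag_act g p) p) < e.
Proof.
move=> e0; rewrite tensor_kernelxx.
(* Real parts above [1 - d] leave imaginary parts with squares at most [2 d], so the real part of
   the product drops by at most [4 d <= e / 2]. *)
pose d := Num.min 1 (e / 8); have d0 : 0 < d by rewrite lt_min ltr01 divr_gt0.
have d1 : d <= 1 by rewrite ge_min lexx.
have de : d <= e / 8 by rewrite ge_min lexx orbT.
apply: filterS2 (matcoef_near1 p.1 d0) (matcoef_near1 p.2 d0) => g.
rewrite /= /tensor_kernel_fun /= (matcoefC (g * p.1)%g).
have := matcoef_le1 (g * p.1)%g p.1; have := matcoef_le1 (g * p.2)%g p.2.
case: (matcoef _ p.1) => a b; case: (matcoef _ p.2) => u v /= uv ab ad ud.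
have au : (1 - d) * (1 - d) <= a * u by apply: ler_pM; lra.
have aa : (1 - d) * (1 - d) <= a * a by apply: ler_pM; lra.
have uu : (1 - d) * (1 - d) <= u * u by apply: ler_pM; lra.
have := sqr_ge0 (b - v); have := sqr_ge0 (b + v); have := sqr_ge0 d; rewrite !expr2; nra.
Qed.

Local Notation K := tensor_kernel.

(* Represents the operator [X^h *m c *m X], where the rows of [X] are coordinates
   of the vectors [pi (x i) xi]. *)
Definition matrix_comb n (c : 'M[R[i]]_n) (x : 'I_n -> G) :=
  [seq (c p.1 p.2, (x p.1, x p.2)) | p <- index_enum ('I_n * 'I_n)%type].

Lemma big_matrix_comb n (c : 'M[R[i]]_n) (x : 'I_n -> G) (F : R[i] * (G * G) -> R[i]) :
  \sum_(p <- matrix_comb c x) F p = \sum_i \sum_j F (c i j, (x i, x j)).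
Proof. by rewrite big_map pair_bigA. Qed.

(** By cyclicity of the trace only [X *m Y^h] enters, and its entries are the matrix coefficients in
    the kernel. The norm is thus the Hilbert-Schmidt norm. *)
Lemma pairing_matrix_comb n m (c d : 'M[R[i]]_n) (x y : 'I_n -> G)
    (X Y : 'M[R[i]]_(n, m)) :
  (forall i j, matcoef (x i) (y j) = (X *m Y^h) i j) ->
  pairing (kernel_comb K (matrix_comb c x)) (matrix_comb d y) =
  \tr ((X^h *m c *m X) *m (Y^h *m d *m Y)^h).
Proof.
move=> XY; have [Z ZE] : exists Z, Z = X *m Y^h by eexists.
have -> : \tr ((X^h *m c *m X) *m (Y^h *m d *m Y)^h) = \tr (c *m Z *m d^h *m Z^h).
  by rewrite ZE !adjmxM !adjmxK -!mulmxA [LHS]mxtrace_mulC -!mulmxA.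
rewrite pairing_kernel_comb big_matrix_comb; apply: eq_bigr => i _.
rewrite mxE; under eq_bigr do rewrite big_matrix_comb.
rewrite exchange_big; apply: eq_bigr => k _.
rewrite mxE mulr_suml exchange_big; apply: eq_bigr => l _.
rewrite mxE !mulr_suml; apply: eq_bigr => j _.
rewrite /= /tensor_kernel_fun /= (matcoefC (x i)) !XY -ZE !mxE; ring.
Qed.

End TensorKernel.

(** * Quadratic forms of diagonal sign matrices *)

Section SignedSquares.
Variable R : realType.

Definition sqmod (z : R[i]) : R := complex.Re z ^+ 2 + complex.Im z ^+ 2.

Lemma sqmod_ge0 z : 0 <= sqmod z.
Proof. by rewrite addr_ge0// sqr_ge0. Qed.

Lemma norm_sqmod (z : R[i]) : `|z| ^+ 2 = (sqmod z)%:C.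
Proof. by rewrite -add_Re2_Im2. Qed.

Lemma sqmod_gram n m (Z : 'M[R[i]]_(n, m)) p r :
  \sum_j sqmod (Z p j - Z r j) = complex.Re ((Z *m Z^h) p p) +
    complex.Re ((Z *m Z^h) r r) - 2 * complex.Re ((Z *m Z^h) p r).
Proof.
have ReZ u v : complex.Re ((Z *m Z^h) u v) =
    \sum_j (complex.Re (Z u j) * complex.Re (Z v j) + complex.Im (Z u j) * complex.Im (Z v j)).
  rewrite mxE raddf_sum; apply: eq_bigr => j _; rewrite !mxE.
  by case: (Z u j) => a b; case: (Z v j) => c d /=; ring.
rewrite !ReZ mulr_sumr -big_split -sumrB; apply: eq_bigr => j _ /=.
rewrite /sqmod; case: (Z p j) => a b; case: (Z r j) => c d /=; ring.
Qed.

Variables (n m : nat) (Z : 'M[R[i]]_(n, m)) (sg : 'I_m -> R).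
Hypothesis sg1 : forall j, (sg j == 1) || (sg j == -1).
Hypothesis Z1 : forall p, \sum_j sqmod (Z p j) = 1.

Definition signed_sqmod p := \sum_j sg j * sqmod (Z p j).

Lemma signed_sqmod_le1 p : `|signed_sqmod p| <= 1.
Proof.
apply: le_trans (ler_norm_sum _ _ _) _; rewrite -(Z1 p); apply: ler_sum => j _.
rewrite normrM (ger0_norm (sqmod_ge0 _)).
by case/orP: (sg1 j) => /eqP ->; rewrite ?normrN normr1 mul1r.
Qed.

(** Each difference of squared moduli is controlled by the difference times the sum of the two
    entries. Cauchy-Schwarz and the unit length of the rows give the Lipschitz constant 2, squared
    here. *)
Lemma signed_sqmod_lipschitz p r :
  (signed_sqmod r - signed_sqmod p) ^+ 2 <= 4 * \sum_j sqmod (Z p j - Z r j).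
Proof.
apply: real_quadratic_le => [|t]; first by rewrite sumr_ge0// => j _; exact: sqmod_ge0.
have -> : 4 = 2 * \sum_j sqmod (Z p j) + 2 * \sum_j sqmod (Z r j) :> R by rewrite !Z1; lra.
rewrite /signed_sqmod -sumrB !mulr_sumr -sumrB -big_split /=; apply: ler_sum => j _.
rewrite /sqmod; case: (Z p j) => a b; case: (Z r j) => c d /=.
have h1 := sqr_ge0 (t * (a - c) - (a + c)); have h2 := sqr_ge0 (t * (a - c) + (a + c)).
have h3 := sqr_ge0 (t * (b - d) - (b + d)); have h4 := sqr_ge0 (t * (b - d) + (b + d)).
have h5 := sqr_ge0 (a - c); have h6 := sqr_ge0 (b - d).
by case/orP: (sg1 j) => /eqP ->; move: h1 h2 h3 h4 h5 h6; rewrite !expr2; nra.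
Qed.

End SignedSquares.

(** * Square roots of averaged rank one operators *)

Section AlmostInvariantVectors.
Variables (R : realType) (G : topologicalGroupType) (H : hilbertType R).
Hypotheses (G_ea : extremely_amenable G) (G_sin : SIN G).
Variable pi : G -> unitary_group H.
Hypothesis pi_rep : unitary_representation pi.
Variable xi : H.
Hypothesis xi1 : sqn xi = 1.
Local Notation K := (tensor_kernel pi xi).
Local Notation matcoef := (matcoef pi xi).

Lemma translate_matrix_comb n (c : 'M[R[i]]_n) (x : 'I_n -> G) g :
  translate_comb (@diag_act G) g (matrix_comb c x) =
  matrix_comb c (fun i => (g * x i)%g).
Proof. by rewrite /translate_comb /matrix_comb -map_comp. Qed.

Lemma comb_sqnorm_matrixB n m (c : 'M[R[i]]_n) (x y : 'I_n -> G)
    (X Y : 'M[R[i]]_(n, m)) :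
  (forall i j, matcoef (x i) (x j) = (X *m X^h) i j) ->
  (forall i j, matcoef (x i) (y j) = (X *m Y^h) i j) ->
  (forall i j, matcoef (y i) (y j) = (Y *m Y^h) i j) ->
  let D := X^h *m c *m X - Y^h *m c *m Y in
  comb_sqnorm K (matrix_comb c x ++ scale_comb (- 1)%:C (matrix_comb c y)) =
  complex.Re (\tr (D *m D^h)).
Proof.
move=> XX XY YY D.
rewrite comb_sqnorm_cat comb_sqnorm_scale_real Re_pairing_scale_real.
rewrite /comb_sqnorm (pairing_matrix_comb _ _ XX) (pairing_matrix_comb _ _ XY).
rewrite (pairing_matrix_comb _ _ YY) /D.
move: (X^h *m c *m X) (Y^h *m c *m Y) => {D XX XY YY} S T.
have TS : \tr (T *m S^h) = Num.conj (\tr (S *m T^h)).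
  by rewrite /mxtrace rmorph_sum; apply: eq_bigr => i _; rewrite -[in LHS](adjmxK T) -adjmxM !mxE.
have trB (A B : 'M[R[i]]_m) : \tr (A - B) = \tr A - \tr B.
  by rewrite /mxtrace -sumrB; apply: eq_bigr => i _; rewrite !mxE.
rewrite adjmxB mulmxBl !mulmxBr !trB TS.
case: (\tr (S *m S^h)) => a b; case: (\tr (T *m T^h)) => a' b'.
by case: (\tr (S *m T^h)) => u v /=; ring.
Qed.

Lemma almost_invariant_comb m (q : 'I_m -> G) (eps : R) : 0 < eps ->
  exists s, comb_sqnorm K s = 1 /\ forall i, comb_sqnorm K
    (s ++ scale_comb (- 1)%:C (translate_comb (@diag_act G) (q i) s)) <= eps.
Proof.
move=> e0.
(* The factor 2 is the Lipschitz constant of the signed forms on unit vectors. *)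
pose rho g := 2 * displacement pi xi g.
have rhoJ g h : rho (g ^ h)%g = rho g by rewrite /rho displacementJ.
have rhoV g : rho g^-1%g = rho g by rewrite /rho displacementV.
have rho_ge0 g : 0 <= rho g by rewrite mulr_ge0// displacement_ge0.
have rho1 : rho 1%g = 0 by rewrite /rho displacement1// mulr0.
have rhoM g h : rho (g * h)%g <= rho g + rho h.
  by rewrite /rho -mulrDr ler_pM2l// displacementM.
have rho_small e : 0 < e -> \forall g \near 1%g, rho g < e.
  move=> ep; have e2 : 0 < e / 2 by rewrite divr_gt0.
  apply: filterS (displacement_small pi_rep xi G_sin e2) => g; rewrite /rho; lra.
have [n [x [mu [mu0 mu1 muP]]]] := folner G_ea rhoJ rhoV rho_small 1 q e0.
(* Square roots of the weights: if the rows of [X] are coordinates of the orbit vectors,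
   [(E *m X)^h *m (E *m X)] is the averaged rank one operator. *)
pose Ed : 'M[R[i]]_n.+1 := diag_mx (\row_i (Num.sqrt (mu i))%:C).
have [E EE] : exists E, E = Ed by eexists.
have Eh : E^h = E.
  by rewrite EE adj_diag_mx// => i; rewrite mxE ger0_real// ler0c sqrtr_ge0.
have Emul p (A : 'M[R[i]]_(n.+1, p)) i j : (E *m A) i j = (Num.sqrt (mu i))%:C * A i j.
  by rewrite EE /Ed mul_diag_mxE mxE.
have [B0 B0E] := gram_factorization (fun i => pi (x i) xi).
have [N NE] : exists N, N = (E *m B0) *m (E *m B0)^h by eexists.
have [e eP] : exists e : 'M[R[i]]_n.+1, forall m (V : 'M[R[i]]_(n.+1, m)), V *m V^h = N ->
    let S := V^h *m (e^h *m e) *m V in S *m S = V^h *m V.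
  by apply: gram_inv_sqrt; exists n.+1, (E *m B0).
(* These coefficients depend only on the Gram matrix, so they represent the square root for the
   points [x i] and for their translates alike. *)
pose c := E *m (e^h *m e) *m E.
have cE p (X : 'M[R[i]]_(n.+1, p)) : X^h *m c *m X = (E *m X)^h *m (e^h *m e) *m (E *m X).
  by rewrite /c adjmxM Eh !mulmxA.
have gramN p (X : 'M[R[i]]_(n.+1, p)) :
    (forall i j, matcoef (x i) (x j) = (X *m X^h) i j) -> (E *m X) *m (E *m X)^h = N.
  move=> XX; rewrite NE !adjmxM Eh !mulmxA -(mulmxA E X) -(mulmxA E B0).
  congr (E *m _ *m E); apply/matrixP => i j; rewrite -XX -B0E //.
have ssq i : Num.sqrt (mu i) ^+ 2 = mu i by rewrite sqr_sqrtr.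
exists (matrix_comb c x); split.
  rewrite /comb_sqnorm (pairing_matrix_comb c c B0E) cE.
  have := eP _ _ (gramN _ _ B0E) => /=.
  set S := (X in X *m X = _) => SS.
  have Sh : S^h = S by rewrite /S !adjmxM !adjmxK !mulmxA.
  (* The squared Hilbert-Schmidt norm of the square root is the trace of the averaged operator, that
     is, the total mass of [mu]. *)
  rewrite Sh SS mxtrace_mulC /mxtrace raddf_sum -mu1; apply: eq_bigr => i _.
  have -> : (E *m B0 *m (E *m B0)^h) i i = (mu i)%:C.
    rewrite mulmx_adj_diagE.
    under eq_bigr do rewrite Emul normrM exprMn.
    rewrite -mulr_sumr -mulmx_adj_diagE -B0E [inner _ _](matcoefxx pi xi1) mulr1.
    by rewrite norm_sqmod /sqmod /= expr0n addr0 ssq.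
  by [].
move=> i0; rewrite translate_matrix_comb.
pose k := q i0.
(* Listing the points with their translates gives common coordinates, in which both square roots are
   matrices of the same size. *)
pose z (p : 'I_(n.+1 + n.+1)) : G :=
  match fintype.split p with inl i => x i | inr i => (k * x i)%g end.
have zl i : z (lshift _ i) = x i by rewrite /z (unsplitK (inl _ i)).
have zr i : z (rshift _ i) = (k * x i)%g by rewrite /z (unsplitK (inr _ i)).
have [B BE] := gram_factorization (fun p => pi (z p) xi).
pose X := usubmx B; pose Y := dsubmx B.
have XX i j : matcoef (x i) (x j) = (X *m X^h) i j.
  rewrite -!zl [LHS]BE !mxE; apply: eq_bigr => l _; rewrite !mxE //.
have XY i j : matcoef (x i) (k * x j)%g = (X *m Y^h) i j.
  rewrite -zl -zr [LHS]BE !mxE; apply: eq_bigr => l _; rewrite !mxE //.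
have YY i j : matcoef (k * x i)%g (k * x j)%g = (Y *m Y^h) i j.
  rewrite -!zr [LHS]BE !mxE; apply: eq_bigr => l _; rewrite !mxE //.
rewrite (comb_sqnorm_matrixB _ XX XY YY) /= !cE.
have YY' i j : matcoef (x i) (x j) = (Y *m Y^h) i j by rewrite -YY matcoefM.
have [U [sg [UU UU' sg1 trP]]] := powers_stormer (eP _ _ (gramN _ _ XX)) (eP _ _ (gramN _ _ YY')).
pose Z := B *m U^h.
pose sr j := complex.Re (sg j).
have sgE j : sg j = (sr j)%:C.
  by rewrite /sr; case/orP: (sg1 j) => /eqP ->; rewrite ?rmorphN rmorph1.
have sr1 j : (sr j == 1) || (sr j == -1).
  by rewrite /sr; case/orP: (sg1 j) => /eqP -> /=; rewrite ?oppr0 eqxx ?orbT.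
have ZZ : Z *m Z^h = B *m B^h.
  by rewrite /Z adjmxM adjmxK mulmxA -(mulmxA B) UU' mulmx1.
have Z1 p : \sum_j sqmod (Z p j) = 1.
  apply: (@complexI R); rewrite rmorph_sum -[RHS](matcoefxx pi xi1 (z p)) [RHS]BE -ZZ.
  by rewrite mulmx_adj_diagE; apply: eq_bigr => j _; rewrite norm_sqmod.
(* The sign is reversed because [folner] bounds the value at the translate minus the value at the
   point, whereas the matrix inequality has the opposite difference. *)
have phiL p r : - signed_sqmod Z sr r - - signed_sqmod Z sr p <= rho ((z p)^-1 * z r)%g.
  rewrite -rhoV invgM invgK opprK addrC.
  have := signed_sqmod_lipschitz sr1 Z1 r p; rewrite sqmod_gram ZZ -!BE => L.
  have {}L : (signed_sqmod Z sr p - signed_sqmod Z sr r) ^+ 2 <=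
      (2 * nrm (pi (z r) xi - pi (z p) xi)) ^+ 2.
    by rewrite exprMn sqr_nrm sqnB /rin /sqn; move: L; lra.
  apply: le_trans (ler_norm _) _.
  apply: (@le_trans _ _ (2 * nrm (pi (z r) xi - pi (z p) xi))).
    rewrite -(@ler_pXn2r _ 2) ?nnegrE ?mulr_ge0 ?nrm_ge0//.
    by rewrite real_normK ?num_real.
  by rewrite /rho ler_pM2l//; exact: nrm_rep_displacement.
have phi1 p : `|- signed_sqmod Z sr p| <= 1 by rewrite normrN; exact: signed_sqmod_le1.
have [f [f1 fL fz]] := lipschitz_extension rho_ge0 rho1 rhoM phi1 phiL.
(* A tuple that vanishes outside [i0] extracts the estimate for this single group element. *)
have := muP (fun i => if i == i0 then f else fun=> 0) _.
have FL i : rho_lipschitz rho 1 (if i == i0 then f else fun=> 0).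
  by case: eqP => // _; split=> [a|a b]; rewrite ?normr0// subrr.
move=> /(_ FL) h; apply: (le_trans _ h) => {h}.
have -> : \sum_j mu j * (\sum_i ((if i == i0 then f else fun=> 0) (q i * x j)%g -
      (if i == i0 then f else fun=> 0) (x j))) =
    \sum_j mu j * (signed_sqmod Z sr (lshift _ j) - signed_sqmod Z sr (rshift _ j)).
  apply: eq_bigr => j _; congr (_ * _).
  rewrite (bigD1 i0)//= eqxx big1 => [|i /negbTE ->]; last by rewrite subrr.
  by rewrite addr0 -[(q i0 * x j)%g]zr -(zl j) !fz; ring.
have RE : \sum_j sg j * \sum_i (`|(E *m X *m U^h) i j| ^+ 2 - `|(E *m Y *m U^h) i j| ^+ 2) =
    (\sum_j sr j * \sum_i mu i * (sqmod (Z (lshift _ i) j) - sqmod (Z (rshift _ i) j)))%:C.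
  rewrite rmorph_sum; apply: eq_bigr => j _; rewrite sgE rmorphM rmorph_sum.
  congr (_ * _); apply: eq_bigr => i _.
  rewrite -!mulmxA !Emul mul_usub_mx mul_dsub_mx -/Z !mxE !normrM !exprMn -mulrBr.
  rewrite !norm_sqmod rmorphM rmorphB /=; congr (_%:C * _).
  by rewrite /sqmod /= expr0n addr0 ssq.
move: trP; rewrite RE lecE => /andP[_ /= trP]; apply: (le_trans trP).
rewrite le_eqVlt; apply/orP; left; apply/eqP.
under eq_bigr do rewrite mulr_sumr.
rewrite exchange_big; apply: eq_bigr => i _ /=.
rewrite /signed_sqmod -sumrB mulr_sumr; apply: eq_bigr => j _; ring.
Qed.

End AlmostInvariantVectors.

(** * Small convex combinations in the orbit of a coboundary *)

Section ConvexHullOfOrbit.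
Variables (R : realType) (G : topologicalGroupType) (H : hilbertType R).
Hypotheses (G_ea : extremely_amenable G) (G_sin : SIN G).
Variable pi : G -> unitary_group H.
Hypothesis pi_rep : unitary_representation pi.

Lemma nrm_convex n (mu : 'I_n -> R) (v : 'I_n -> H) M :
  (forall j, 0 <= mu j) -> \sum_j mu j = 1 -> (forall j, nrm (v j) <= M) ->
  nrm (\sum_j (mu j)%:C *: v j) <= M.
Proof.
move=> mu0 mu1 vM; rewrite -lecR -norm_nrm.
apply: le_trans (ler_norm_sum _ _ _) _.
rewrite -[M]mul1r -mu1 mulr_suml rmorph_sum; apply: ler_sum => j _.
rewrite normrZ norm_nrm ger0_norm ?ler0c// rmorphM /=.
by apply: ler_wpM2l; rewrite ?ler0c// lecR.
Qed.

(** For the combination [w], the function [F h = Re <pi h^-1 xi, w>] has average increment under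
    [g^-1] exactly equal to the squared norm of [w]. Although [F] depends on the weights, the
    estimate of [folner] is uniform in the test function and applies to it. *)
Lemma convex_orbit_small (xi : H) (g : G) (eps : R) : 0 < eps ->
  exists n (x : 'I_n.+1 -> G) (mu : 'I_n.+1 -> R),
  [/\ forall j, 0 <= mu j, \sum_j mu j = 1 &
    sqn (\sum_j (mu j)%:C *: pi (x j) (pi g xi - xi)) <= eps].
Proof.
move=> e0; pose rho h := 2 * nrm xi * displacement pi xi h.
have rhoJ h k : rho (h ^ k)%g = rho h by rewrite /rho displacementJ.
have rhoV h : rho h^-1%g = rho h by rewrite /rho displacementV.
have rho_small e : 0 < e -> \forall h \near 1%g, rho h < e.
  move=> ep; have D0 : 0 < 2 * nrm xi + 1 by rewrite ltr_wpDl// mulr_ge0// nrm_ge0.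
  apply: filterS (displacement_small pi_rep xi G_sin (divr_gt0 ep D0)) => h.
  rewrite ltr_pdivlMr// => hd; apply: le_lt_trans hd; rewrite /rho mulrC ler_wpM2l//.
    exact: displacement_ge0.
  by rewrite lerDl.
have [n [x [mu [mu0 mu1 muP]]]] :=
  folner G_ea rhoJ rhoV rho_small (2 * nrm xi ^+ 2) (fun _ : 'I_1 => g^-1%g) e0.
exists n, (fun j => (x j)^-1%g), mu; split=> //.
set w := \sum_j _.
have wM : nrm w <= 2 * nrm xi.
  apply: nrm_convex => // j; rewrite rep_nrm; apply: le_trans (nrm_triangle _ _) _.
  by rewrite nrmN rep_nrm; lra.
pose F h := rin (pi h^-1%g xi) w.
have FL (i : 'I_1) : rho_lipschitz rho (2 * nrm xi ^+ 2) F.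
  split=> [a|a b].
    apply: le_trans (norm_rin_le _ _) _; rewrite rep_nrm expr2 mulrCA.
    by rewrite ler_wpM2l// nrm_ge0.
  rewrite /F -rinBl; apply: le_trans (ler_norm _) _.
  apply: le_trans (norm_rin_le _ _) _; rewrite /rho mulrC.
  apply: ler_pM; rewrite ?nrm_ge0//.
  apply: le_trans (nrm_rep_displacement pi_rep _ _ _) _.
  (* The orbit map at inverses yields [b * a^-1]; conjugation by [a] turns it into the required
     [a^-1 * b]. *)
  rewrite invgK -(displacementJ pi xi (b * a^-1)%g a) conjgE -!mulgA mulVg mulg1.
  by [].
have := muP (fun=> F) FL; apply: le_trans; rewrite le_eqVlt; apply/orP; left; apply/eqP.
rewrite -[sqn w]/(rin w w) {1}/w /rin inner_suml raddf_sum; apply: eq_bigr => j _.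
rewrite innerZl big_ord1 /F -rinBl invgM invgK (repM pi_rep) -repB /rin.
by case: (inner _ _) => a b /=; ring.
Qed.

End ConvexHullOfOrbit.

(** * Finite nets and invariant elements *)

Lemma finite_family_net (R : realType) (T : eqType) (phi : nat -> T -> R) (d : R) :
  0 < d -> (forall i t, `|phi i t| <= 1) ->
  forall n (A : set T), exists s : seq T, forall g, A g ->
    exists2 h, h \in s & A h /\ forall i, (i < n)%N -> `|phi i g - phi i h| <= d.
Proof.
move=> d0 phi1; elim=> [|n IH] A.
  have [[a Aa]|nA] := pselect (exists a, A a); last by exists [::] => g Ag; case: nA; exists g.
  by exists [:: a] => g _; exists a; rewrite ?inE.
(* The values of the new function are cut into cells of width [d], and the induction hypothesis is
   applied inside each cell. *)
pose cell g := Num.truncn ((phi n g + 1) / d).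
have [s sP] := choice (fun k : nat => IH [set g | A g /\ cell g = k]).
(* Since [phi n + 1] lies between 0 and 2, the cell indices are at most [truncn (2 / d)]. *)
pose m := (Num.truncn (2 / d)).+1.
exists (flatten [seq s k | k <- iota 0 m]) => g Ag.
have phi0 t : 0 <= (phi n t + 1) / d.
  by rewrite divr_ge0 ?(ltW d0)//; have := phi1 n t; rewrite ler_norml => /andP[]; lra.
have [h hs [[Ah hg] hP]] := sP (cell g) g (conj Ag erefl).
exists h.
  apply/flattenP; exists (s (cell g)) => //; apply: map_f; rewrite mem_iota /= add0n ltnS.
  rewrite /cell; apply: le_truncn; rewrite ler_pM2r ?invr_gt0//.
  by have := phi1 n g; rewrite ler_norml => /andP[]; lra.
split=> // i; rewrite ltnS leq_eqVlt => /orP[/eqP->|/hP//].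
have /andP[g1 g2] := truncn_itv (phi0 g); have /andP[h1 h2] := truncn_itv (phi0 h).
move: g1 g2 h1 h2; rewrite -/(cell g) -/(cell h) hg -natr1.
rewrite !ler_pdivlMr// !ltr_pdivrMr// ler_norml => *; apply/andP; split; lra.
Qed.

Lemma norm_le_sqmod (R : realType) (z : R[i]) (e : R) : 0 <= e ->
  (`|z| <= e%:C) = (sqmod z <= e ^+ 2).
Proof.
move=> e0.
have -> : (`|z| <= e%:C) = (`|z| ^+ 2 <= e%:C ^+ 2).
  by rewrite ler_pXn2r// ?nnegrE ?ler0c.
by rewrite norm_sqmod -rmorphXn /= lecR.
Qed.

Lemma norm_Re_Im_le (R : realType) (z : R[i]) (e : R) : `|z| <= e%:C ->
  `|complex.Re z| <= e /\ `|complex.Im z| <= e.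
Proof.
move=> ze; have e0 : 0 <= e by rewrite -(@ler0c R); apply: le_trans ze.
rewrite norm_le_sqmod// /sqmod in ze.
have h1 := sqr_ge0 (complex.Re z); have h2 := sqr_ge0 (complex.Im z).
by split; rewrite -(@ler_pXn2r _ 2) ?nnegrE// real_normK ?num_real//; lra.
Qed.

Section InvariantElements.
Variables (R : realType) (G : topologicalGroupType) (H : hilbertType R).
Hypothesis G_ea : extremely_amenable G.
Variable pi : G -> unitary_group H.
Hypothesis pi_rep : unitary_representation pi.
Variable xi : H.
Hypothesis xi1 : sqn xi = 1.
Local Notation K := (tensor_kernel pi xi).
Local Notation matcoef := (matcoef pi xi).
Local Notation N := (@rkhs_sqnorm R (G * G)%type K).

Lemma tensor_comb_sqnorm2 c p p' : comb_sqnorm K [:: (c, p); (- c, p')] =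
  sqmod c * (2 - 2 * complex.Re (K p p')).
Proof.
have K1 u : tensor_kernel_fun pi xi u u = 1 := tensor_kernelxx pi xi1 u.
rewrite /comb_sqnorm /pairing /kernel_comb !big_cons !big_nil !addr0 /= !K1.
rewrite (tensor_kernel_hermitian pi xi p p') /sqmod.
by case: c => a b; case: (tensor_kernel_fun _ _ _ _) => u v /=; ring.
Qed.

(** Cauchy-Schwarz against the difference of two kernel functions, whose squared norm is
    [2 - 2 Re K(p, p')] as the diagonal of [K] is 1. *)
Lemma rkhs_sub_le (f : rkhs K) p p' :
  sqmod (f p - f p') <= N f * (2 - 2 * complex.Re (K p p')).
Proof.
set c := f p - f p'; pose s := [:: (c, p); (- c, p')].
have Ps : complex.Re (pairing f s) = sqmod c.
  rewrite /pairing /s big_cons big_seq1 /= rmorphN mulNr -mulrBr -/c.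
  by rewrite /sqmod; case: (c) => a b /=; ring.
have := pairing_cauchy_schwarz f s; rewrite Ps tensor_comb_sqnorm2.
have [->|c0] := eqVneq (sqmod c) 0.
  move=> _; rewrite mulr_ge0 ?rkhs_sqnorm_ge0//.
  have := comb_sqnorm_ge0 K [:: (1, p); (- 1, p')].
  by rewrite tensor_comb_sqnorm2 /sqmod /= expr1n expr0n addr0 mul1r.
have cp : 0 < sqmod c by rewrite lt0r c0 sqmod_ge0.
by rewrite expr2 mulrCA ler_pM2l.
Qed.

Lemma norm_matcoef_le1 a b : `|matcoef a b| <= 1.
Proof. by rewrite -[1]/(1%:C) norm_le_sqmod// expr1n; exact: matcoef_le1. Qed.

(** In the variable [g] a combination involves finitely many matrix coefficients, with multipliers
    bounded uniformly in [a]; it suffices to approximate those coefficients. *)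
Lemma kernel_comb_net s (e : R) : 0 < e ->
  exists t : seq G, forall g, exists2 h, h \in t &
    forall a, `|kernel_comb K s (a, g) - kernel_comb K s (a, h)| <= e%:C.
Proof.
move=> e0; pose C := \sum_(p <- s) Num.sqrt (sqmod p.1).
have C0 : 0 <= C by rewrite sumr_ge0// => p _; rewrite sqrtr_ge0.
pose d := e / (2 * (C + 1)).
have d0 : 0 < d by rewrite divr_gt0// mulr_gt0// ltr_wpDl.
pose b i := (nth (0, (1%g, 1%g)) s i).2.2.
(* Even indices carry real parts and odd ones imaginary parts, whence the doubled length of the
   family. *)
pose phi i (g : G) := if odd i then complex.Im (matcoef (b i./2) g)
  else complex.Re (matcoef (b i./2) g).
have phi1 i g : `|phi i g| <= 1.
  by rewrite /phi; case: odd; have [] := norm_Re_Im_le (norm_matcoef_le1 (b i./2) g).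
have [t tP] := finite_family_net d0 phi1 (size s).*2 setT.
exists t => g; have [h ht [_ hP]] := tP g I; exists h => // a.
have close p : p \in s -> `|matcoef p.2.2 g - matcoef p.2.2 h| <= (2 * d)%:C.
  move=> ps; have ip : (index p s < size s)%N by rewrite index_mem.
  have := hP (index p s).*2; rewrite ltn_double => /(_ ip).
  have := hP (index p s).*2.+1; rewrite ltn_Sdouble => /(_ ip).
  rewrite /phi /b /= odd_double /= uphalf_double doubleK nth_index//.
  rewrite norm_le_sqmod; last by rewrite mulr_ge0// ltW.
  rewrite /sqmod; case: (matcoef _ g) => u v; case: (matcoef _ h) => u' v' /=.
  rewrite !ler_norml => /andP[h1 h2] /andP[h3 h4]; rewrite -/d.
  have q1 : (u - u') ^+ 2 <= d ^+ 2.
    by rewrite -[leLHS]real_normK ?num_real// ler_pXn2r ?nnegrE ?(ltW d0)// ler_norml h3 h4.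
  have q2 : (v - v') ^+ 2 <= d ^+ 2.
    by rewrite -[leLHS]real_normK ?num_real// ler_pXn2r ?nnegrE ?(ltW d0)// ler_norml h1 h2.
  have q3 := sqr_ge0 d; lra.
apply: (@le_trans _ _ (C * (2 * d))%:C); last first.
  rewrite lecR /d; have D0 : 0 < 2 * (C + 1) by rewrite mulr_gt0// ltr_wpDl.
  by rewrite mulrA mulrA ler_pdivrMr//; nra.
rewrite /kernel_comb -sumrB; apply: le_trans (ler_norm_sum _ _ _) _.
rewrite /C mulr_suml rmorph_sum big_seq [leRHS]big_seq; apply: ler_sum => p ps.
rewrite -mulrBr normrM rmorphM /=; apply: ler_pM => //.
  by rewrite normc_def.
rewrite /tensor_kernel_fun /= -mulrBr normrM -[leRHS]mul1r.
by apply: ler_pM => //; [exact: norm_matcoef_le1|exact: close].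
Qed.

(** The diagonal of [K] being 1, the Hilbert norm dominates the uniform norm, so nets pass from the
    dense kernel combinations to all elements. *)
Lemma rkhs_net (f : rkhs K) (e : R) : 0 < e ->
  exists t : seq G, forall g, exists2 h, h \in t &
    forall a, `|f (a, g) - f (a, h)| <= e%:C.
Proof.
move=> e0; have e30 : 0 < e / 3 by rewrite divr_gt0.
have [s fs] := kernel_elt_dense f (exprn_gt0 2 e30).
have fk p : `|f p - kernel_comb K s p| <= (e / 3)%:C.
  rewrite norm_le_sqmod ?(ltW e30)//.
  have := rkhs_eval_le (f - kernel_elt K s) p.
  rewrite [K p p](tensor_kernelxx pi xi1) mulr1 => /le_trans; apply; exact: ltW.
have [t tP] := kernel_comb_net s e30.
exists t => g; have [h ht hP] := tP g; exists h => // a.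
have -> : e = e / 3 + e / 3 + e / 3 by lra.
rewrite -(subrKA (kernel_comb K s (a, g))).
have -> : kernel_comb K s (a, g) - f (a, h) =
    (kernel_comb K s (a, g) - kernel_comb K s (a, h)) + (kernel_comb K s (a, h) - f (a, h)).
  by rewrite subrKA.
rewrite -[X in X%:C]addrA rmorphD /=; apply: le_trans (ler_normD _ _) _.
apply: lerD; first exact: fk.
rewrite rmorphD /=; apply: le_trans (ler_normD _ _) _; apply: lerD; first exact: hP.
by rewrite distrC; exact: fk.
Qed.

(** Diagonal invariance makes [f (a, b)] a function [u] of [a^-1 * b]. It is continuous by
    [rkhs_sub_le] and almost periodic by [rkhs_net], so its real and imaginary parts are
    constant. *)
Lemma invariant_rkhs_constant (f : rkhs K) : N f = 1 ->
  (forall g a b, f ((g * a)%g, (g * b)%g) = f (a, b)) ->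
  forall p p', f p = f p'.
Proof.
move=> f1 finv; pose u x := f (1%g, x).
have fu a b : f (a, b) = u (a^-1 * b)%g by rewrite /u -(finv a 1%g) mulg1 mulgA mulgV mul1g.
have uc x e : 0 < e -> \forall y \near x, `|u x - u y| <= e%:C.
  move=> e0; have ms d : 0 < d -> \forall g \near 1%g, nrm (pi g xi - xi) < d.
    by move=> d0; exact: rep_near.
  apply: filterS (rho_small_at ms x e0) => y xy; rewrite norm_le_sqmod ?(ltW e0)//.
  apply: le_trans (rkhs_sub_le _ _ _) _; rewrite f1 mul1r.
  rewrite /= /tensor_kernel_fun /= (matcoefxx pi xi1) mul1r.
  apply: (@le_trans _ _ (sqn (pi (x^-1 * y)%g xi - xi))).
    rewrite -(rep_sqn pi x) repB -(repM pi_rep) mulgA mulgV mul1g.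
    rewrite sqnB !rep_sqn xi1 /rin.
    by rewrite -[inner _ _]/(matcoef y x) (matcoefC pi xi x y); case: (matcoef x y) => ? ? /=; lra.
  by rewrite -sqr_nrm ler_pXn2r ?nnegrE ?nrm_ge0 ?(ltW e0)// ltW.
have unet e : 0 < e -> exists t : seq G, forall g, exists2 h, h \in t &
    forall a, `|u (a * g)%g - u (a * h)%g| <= e%:C.
  move=> e0; have [t tP] := rkhs_net f e0; exists t => g.
  have [h ht hP] := tP g; exists h => // a.
  by have := hP a^-1%g; rewrite !fu !invgK.
have ub x : `|u x| <= 1%:C.
  rewrite norm_le_sqmod// expr1n; have := rkhs_eval_le f (1%g, x).
  by rewrite f1 mul1r [K _ _](tensor_kernelxx pi xi1).
have uRe : forall a b, complex.Re (u a) = complex.Re (u b).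
  apply: (@almost_periodic_constant R G G_ea (fun x => complex.Re (u x)) 1).
  - by move=> a; have [] := norm_Re_Im_le (ub a).
  - move=> x; apply/cvgrPdist_le => e e0; apply: filterS (uc x e e0) => y.
    by move=> /norm_Re_Im_le[]; rewrite raddfB.
  - move=> e e0; have [t tP] := unet e e0; exists t => g.
    have [h ht hP] := tP g; exists h => // a.
    by have [] := norm_Re_Im_le (hP a); rewrite raddfB.
have uIm : forall a b, complex.Im (u a) = complex.Im (u b).
  apply: (@almost_periodic_constant R G G_ea (fun x => complex.Im (u x)) 1).
  - by move=> a; have [] := norm_Re_Im_le (ub a).
  - move=> x; apply/cvgrPdist_le => e e0; apply: filterS (uc x e e0) => y.
    by move=> /norm_Re_Im_le[]; rewrite !raddfB.
  - move=> e e0; have [t tP] := unet e e0; exists t => g.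
    have [h ht hP] := tP g; exists h => // a.
    by have [] := norm_Re_Im_le (hP a); rewrite !raddfB.
move=> [a b] [a' b']; rewrite !fu; apply/eqP; rewrite eq_complex.
by apply/andP; split; apply/eqP; [exact: uRe|exact: uIm].
Qed.

(** Cauchy-Schwarz against the kernel functions at the points [(x j, 1)] with weights [c * mu j]:
    the second factor of the kernel is 1 there, so only the convex combination of orbit vectors
    remains. *)
Lemma constant_rkhs_le (f : rkhs K) c n (x : 'I_n -> G) (mu : 'I_n -> R) :
  (forall p, f p = c) -> \sum_j mu j = 1 ->
  sqmod c <= N f * sqn (\sum_j (mu j)%:C *: pi (x j) xi).
Proof.
move=> fc mu1.
pose s : seq (R[i] * (G * G)) :=
  [seq (c * (mu j)%:C, (x j, 1%g)) | j <- index_enum 'I_n].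
have Ps : complex.Re (pairing f s) = sqmod c.
  rewrite /pairing /s big_map (_ : \sum_(j <- _) _ = \sum_j (mu j)%:C * (Num.conj c * c)).
    rewrite -mulr_suml -rmorph_sum mu1 mul1r /sqmod.
    by case: (c) => a b /=; ring.
  apply: eq_bigr => j _ /=; rewrite fc rmorphM /=.
  by case: (c) => a b; apply/eqP; rewrite eq_complex /=; apply/andP; split; apply/eqP; ring.
have qs : comb_sqnorm K s = sqmod c * sqn (\sum_j (mu j)%:C *: pi (x j) xi).
  rewrite /comb_sqnorm pairing_kernel_comb /s big_map.
  rewrite (_ : \sum_(i <- _) _ = (Num.conj c * c) *
      inner (\sum_j (mu j)%:C *: pi (x j) xi) (\sum_j (mu j)%:C *: pi (x j) xi)).
    rewrite innerxx /sqmod; case: (c) => a b /=; ring.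
  rewrite inner_sumr mulr_sumr; apply: eq_bigr => i _; rewrite big_map innerZr inner_suml.
  rewrite !mulr_sumr; apply: eq_bigr => j _ /=; rewrite innerZl /tensor_kernel_fun /=.
  rewrite (matcoefxx pi xi1) mulr1 -[inner _ _]/(matcoef (x j) (x i)).
  have mr k : Num.conj (mu k)%:C = (mu k)%:C by exact: conjc_real.
  by rewrite !rmorphM /= !mr; ring.
have := pairing_cauchy_schwarz f s; rewrite Ps qs.
have [->|c0] := eqVneq (sqmod c) 0.
  by move=> _; rewrite mulr_ge0 ?rkhs_sqnorm_ge0 ?sqn_ge0.
have cp : 0 < sqmod c by rewrite lt0r c0 sqmod_ge0.
by rewrite expr2 mulrCA ler_pM2l.
Qed.

End InvariantElements.

(** * Refutation of a finite Kazhdan set *)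

Theorem corollary5p4 (R : realType) (G : topologicalGroupType)
    (G_hausdorff : hausdorff_space G)
    (G_extremely_amenable : extremely_amenable G)
    (G_SIN : SIN G)
    (G_faithful : exists (H : hilbertType R) (pi : G -> unitary_group H),
       topologically_faithful pi)
    (G_nontrivial : exists g : G, g <> 1%g) :
  ~ strong_property_T R G.
Proof.
move=> [Q Qfin [eps eps0 QK]].
have [H [pi [pi_rep pi_inj _]]] := G_faithful; have [g0 g01] := G_nontrivial.
have [xi0 moved] : exists xi0, pi g0 xi0 - xi0 <> 0.
  apply: contrapT => /forallNP fixed; apply/g01/pi_inj/unitary_ext => x.
  by rewrite (rep1 pi_rep); apply: subr0_eq; exact: contrapT (fixed x).
pose d := pi g0 xi0 - xi0.
have d0 : 0 < nrm d.
  by rewrite lt0r nrm_ge0 andbT; apply/eqP => /nrm_eq0.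
pose xi := (nrm d)^-1%:C *: d.
have xi1 : sqn xi = 1.
  rewrite sqnZ /= expr0n addr0 -sqr_nrm -exprMn.
  by rewrite mulVf ?expr1n// gt_eqF.
pose K := tensor_kernel pi xi.
have [s QE] : exists s : seq G, Q = [set` s] by exact/finite_seqP.
(* The estimate concerns squared norms and is not strict; halving restores strictness. *)
have e0 : 0 < eps ^+ 2 / 2 by rewrite divr_gt0// exprn_gt0.
have [t [t1 tP]] := almost_invariant_comb G_extremely_amenable G_SIN pi_rep xi1
  (fun i => tnth (in_tuple s) i) e0.
pose act := @diag_act G.
have KA := tensor_kernel_act pi_rep xi.
pose T := translate_rep (@diag_act1 G) (@diag_actM G) KA.
have Trep : unitary_representation T.
  apply: translate_representation; exact: tensor_kernel_continuous.
have [|f f1 finv] := QK (rkhs K) T Trep.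
  exists (kernel_elt K t).
    by rewrite rkhs_normE kernel_elt_sqnorm t1 sqrtr1.
  move=> g; rewrite QE /= => gs; have /tnthP[i gi] : g \in in_tuple s by [].
  rewrite rkhs_norm_lt//.
  have -> : kernel_elt K t - T g (kernel_elt K t) =
      kernel_elt K (t ++ scale_comb (- 1)%:C (translate_comb act g t)).
    have -> : T g (kernel_elt K t) = kernel_elt K (translate_comb act g t).
      exact: (translate_kernel_elt (@diag_act1 G) (@diag_actM G) KA g t).
    by rewrite kernel_elt_cat kernel_elt_scaleN1.
  rewrite kernel_elt_sqnorm gi; apply: le_lt_trans (tP i) _; lra.
have Nf : rkhs_sqnorm f = 1.
  have := f1; rewrite rkhs_normE => /complexI s1.
  by rewrite -(sqr_sqrtr (rkhs_sqnorm_ge0 f)) s1 expr1n.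
have fconst := invariant_rkhs_constant G_extremely_amenable pi_rep xi1 Nf _.
have {}fconst p : f p = f (1%g, 1%g).
  apply: fconst => g a b; have /(congr1 (fun h : rkhs K => h (a, b))) := finv g^-1%g.
  by rewrite /= /diag_act /= invgK.
have small e : 0 < e -> sqmod (f (1%g, 1%g)) <= e.
  (* The factor [nrm d ^+ 2] compensates for the normalization of [d] to [xi]. *)
  move=> ep; have e'0 : 0 < e * nrm d ^+ 2 by rewrite mulr_gt0// exprn_gt0.
  have [n [x [mu [mu0 mu1 muP]]]] :=
    convex_orbit_small G_extremely_amenable G_SIN pi_rep xi0 g0 e'0.
  have := constant_rkhs_le xi1 x fconst mu1; rewrite Nf mul1r => /le_trans; apply.
  have -> : \sum_j (mu j)%:C *: pi (x j) xi =
      (nrm d)^-1%:C *: \sum_j (mu j)%:C *: pi (x j) d.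
    rewrite scaler_sumr; apply: eq_bigr => j _.
    by rewrite repZ !scalerA mulrC.
  rewrite sqnZ /= expr0n addr0 exprVn mulrC ler_pdivrMr ?exprn_gt0//.
have f0 : sqmod (f (1%g, 1%g)) = 0.
  apply/eqP; rewrite eq_le sqmod_ge0 andbT; apply/ler_addgt0Pr => e ep.
  by rewrite add0r small.
have : f = 0.
  apply: rkhs_ext => p; rewrite fconst.
  move: f0; rewrite /sqmod; case: (f _) => a b /= ab.
  have a2 := sqr_ge0 a; have b2 := sqr_ge0 b.
  have /eqP : a ^+ 2 = 0 by lra.
  have /eqP : b ^+ 2 = 0 by lra.
  by rewrite !sqrf_eq0 => /eqP -> /eqP ->.
by move=> fz; move: f1; rewrite fz normr0 => /eqP; rewrite eq_sym oner_eq0.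
Qed.
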